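(* Let $d\ge 2$ and let $\mu_0=\sum_{j=1}^M a_j\delta_{x_j}$ with nonzero $a_1,\dots,a_M\in\mathbb{C}$ and distinct points $x_1,\dots,x_M\in X$. Let $N\in\mathbb{N}$, let $\Gamma\subset\{-N,\dots,N\}$ have cardinality $T$, let $\Theta\subset\mathbb{S}^{d-1}$ have finite cardinality $L$, let $L'\le L$, and let $y_0=\Phi\mu_0$. Consider the following conditions. (A1) There exists $\Theta'\subset\Theta$ of cardinality $L'$ such that for each $\theta\in\Theta'$ there exists $c_\theta=(c_{\theta,k})_{k\in\Gamma}\in\mathbb{C}^T$ such that the trigonometric polynomial $p_\theta(t)=\sum_{k\in\Gamma}c_{\theta,k}e^{i2\pi kt}$ satisfies $$\|p_\theta\|_\infty\le 1,\qquad p_\theta(\langle\theta,x_j\rangle)=\operatorname{sgn}(a_j)\quad\forall j=1,\dots,M.$$ (A2) For the set $\Theta'$ of (A1), with $\mathcal{T}_\theta$ denoting the set of extremal points of $p_\theta$ (the points where $|p_\theta|=1$), the set $$\tilde\Delta_{\Theta'}=\bigcap_{\theta\in\Theta'}\bigcup_{t\in\mathcal{T}_\theta}\left(t\theta+\ell_\theta^\perp\right)=\{\tilde x_1,\dots,\tilde x_{\tilde M}\}$$ is finite and the linear map $$A_{\Theta,\Gamma,\tilde\Delta_{\Theta'}}:\mathbb{C}^{\tilde M}\to\mathbb{C}^{T\times L},\qquad a\mapsto\Big(\sum_{j=1}^{\tilde M}a_je^{-i2\pi k\langle\theta,\tilde x_j\rangle}\Big)_{\theta\in\Theta,\,k\in\Gamma}$$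 is injective. If (A1) and (A2) hold, then $\mu_0$ is the unique solution to $(\mathcal{P}_0(y_0))$ and is recovered by the splitting algorithm with parameter $L'$.
   Context: $X=\overline{B}(0,1/2)\subset\mathbb{R}^d$ is the closed Euclidean ball of radius $1/2$ centred at $0$; $\mathcal{M}(X)$ is the space of complex Radon measures with support in $X$; $\|\cdot\|_{TV}$ is the total variation norm; $\delta_x$ is the Dirac measure at $x$. $\mathbb{S}^{d-1}$ is the unit sphere of $\mathbb{R}^d$; for $\theta\in\mathbb{S}^{d-1}$, $\ell_\theta=\{t\theta:t\in\mathbb{R}\}$ and $\ell_\theta^\perp$ is its orthogonal complement. $\operatorname{sgn}(a)=a/|a|$. The Fourier transform of $\mu\in\mathcal{M}(X)$ is $\mathcal{F}\mu(\xi)=\int e^{-i2\pi\langle\xi,x\rangle}\mu(\mathrm{d}x)$, and the sampling operator is $\Phi:\mathcal{M}(X)\to\mathbb{C}^{T\times L}$, $\Phi\mu=(\mathcal{F}\mu(k\theta))_{(k,\theta)\in\Gamma\times\Theta}$. The problem $(\mathcal{P}_0(y_0))$ is $$\min_{\mu\in\mathcal{M}(X)}\{\|\mu\|_{TV}:\Phi\mu=y_0\}.$$ Splitting algorithm, with parameter $L'\le L$ chosen by the user (input $y_0=\Phi\mu_0$; put $y_\theta=(\mathcal{F}\mu_0(k\theta))_{k\in\Gamma}$ and $n=2N+1$): Step 1. For each $\theta\in\Theta$, via semidefinite programming, compute the maximizer $c_\theta$ of $\operatorname{Re}\sum_{k\in\Gamma}\overline{c_k}\,y_{\theta,k}$ over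 $c\in\mathbb{C}^{n}$ (indexed by $\{-N,\dots,N\}$) and Hermitian $Q\in\mathbb{C}^{n\times n}$ subject to $$\begin{bmatrix}Q&c\\c^*&1\end{bmatrix}\succeq0,\qquad \sum_{i=1}^{n-j}Q_{i,i+j}=\begin{cases}1&j=0\\0&j=1,\dots,n-1\end{cases},\qquad c_k=0\ \text{ for }k\notin\Gamma;$$ these constraints are equivalent to $\|\sum_{k\in\Gamma}c_ke^{i2\pi k\cdot}\|_\infty\le1$. Let $p_\theta(t)=\sum_{k\in\Gamma}c_{\theta,k}e^{i2\pi kt}$ and let $\mathcal{T}_\theta=\{t\in[-1/2,1/2]:|p_\theta(t)|=1\}$ be its set of extremal points (found numerically as roots of an associated algebraic polynomial on the unit circle). Step 2. For each subset $\Theta'\subset\Theta$ of cardinality $L'$, let $\tilde\Delta_{\Theta'}=\bigcap_{\theta\in\Theta'}\bigcup_{t\in\mathcal{T}_\theta}(t\theta+\ell_\theta^\perp)$. If $\tilde\Delta_{\Theta'}$ is a discrete set $\{\tilde x_j:j=1,\dots,\tilde M\}$ and the map $A_{\Theta,\Gamma,\tilde\Delta_{\Theta'}}:a\mapsto(\sum_{j=1}^{\tilde M}a_je^{-i2\pi k\langle\theta,\tilde x_j\rangle})_{\theta\in\Theta,k\in\Gamma}$ is injective, then recover $a_{\Theta'}$ as the solution to the linear system $A_{\Theta,\Gamma,\tilde\Delta_{\Theta'}}a_{\Theta'}=y_0$, and let $\mu_{\Theta'}=\sum_{j=1}^{\tilde M}a_{\Theta',j}\delta_{\tilde x_j}$.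 If $\operatorname{sgn}(a_{\Theta',j})=\frac1{|\Theta'|}\sum_{\theta\in\Theta'}p_\theta(\langle\tilde x_j,\theta\rangle)$ for all $j\in\{1,\dots,\tilde M\}$, then return $\mu_{\Theta'}$.
   Formalization: SDP maximizers may be non-unique: any measure the algorithm returns is μ_0, and it is shown to return one when Step 1 yields the p_θ of (A1)–(A2) on Θ' (automatic if the maximizer is unique); the sign test is imposed only where a_{Θ',j}≠0, as sgn(0) is undefined. *)

(* Defs.v *)
From HB Require Import structures.
From mathcomp Require Import all_boot all_order all_algebra.
From mathcomp Require Import finmap.
From mathcomp Require Import all_classical all_reals all_analysis.
From mathcomp Require Import complex.

Set Implicit Arguments.
Unset Strict Implicit.
Unset Printing Implicit Defensive.

Import Order.TTheory GRing.Theory Num.Theory.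
Import numFieldNormedType.Exports.

Local Open Scope classical_set_scope.
Local Open Scope ring_scope.
Local Open Scope complex_scope.
Local Open Scope sesquilinear_scope.

Definition dot (R : realType) (d : nat) (u v : 'rV[R]_d) : R :=
  \sum_(i < d) u 0 i * v 0 i.

(* The library norm on 'rV[R]_d is the sup norm, not the Euclidean one. *)
Definition enorm (R : realType) (d : nat) (u : 'rV[R]_d) : R :=
  Num.sqrt (dot u u).

Definition half_ball (R : realType) (d : nat) : set 'rV[R]_d :=
  [set x | enorm x <= 2^-1].

Definition line (R : realType) (d : nat) (th : 'rV[R]_d) : set 'rV[R]_d :=
  [set t *: th | t in [set: R]].

Definition ortho (R : realType) (d : nat) (S : set 'rV[R]_d) :
    set 'rV[R]_d :=
  [set v | forall w, S w -> dot w v = 0].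

Definition hyperplane (R : realType) (d : nat) (th : 'rV[R]_d) (t : R) :
    set 'rV[R]_d :=
  [set t *: th + v | v in ortho (line th)].

(* e^{is} for real s *)
Definition cis (R : realType) (s : R) : R[i] := cos s +i* sin s.

(* Only meaningful for a != 0: with the library convention x / 0 = 0 it
   returns 0 at 0. *)
Definition csgn (R : realType) (a : R[i]) : R[i] := a / `|a|.

(* R^d with its Borel sigma-algebra. *)
Definition borelRd (R : realType) (d : nat) :=
  g_sigma_algebraType (@open 'rV[R]_d).

(* A complex Borel measure on R^d is given by its real and imaginary parts,
   which are finite signed measures.  Every finite Borel measure on R^d is
   regular, so these are exactly the (finite) complex Radon measures. *)
Record cmeasure (R : realType) (d : nat) := CMeasure {
  cm_re : {charge set (borelRd R d) -> \bar R} ;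
  cm_im : {charge set (borelRd R d) -> \bar R} }.

Definition cm_val (R : realType) (d : nat) (mu : cmeasure R d)
    (A : set (borelRd R d)) : R[i] :=
  fine (cm_re mu A) +i* fine (cm_im mu A).

(* Charges may take arbitrary values on non-measurable sets, so equality of
   measures is equality on measurable sets. *)
Definition cm_eq (R : realType) (d : nat) (mu nu : cmeasure R d) : Prop :=
  forall A, measurable A -> cm_val mu A = cm_val nu A.

(* X being closed, "support in X" says that mu vanishes on every Borel set
   disjoint from X. *)
Definition supported_in (R : realType) (d : nat) (X : set 'rV[R]_d)
    (mu : cmeasure R d) : Prop :=
  forall A : set (borelRd R d),
    measurable A -> A `&` X = set0 -> cm_val mu A = 0.

(* |mu|(R^d), the supremum of sum_i |mu(F_i)| over countable measurable
   partitions of R^d. *)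
Definition TVnorm (R : realType) (d : nat) (mu : cmeasure R d) : \bar R :=
  ereal_sup [set (\sum_(0 <= i <oo) (ComplexField.Normc.normc
                                       (cm_val mu (F i)))%:E)%E
            | F in [set F : nat -> set (borelRd R d) |
                     [/\ forall i, measurable (F i),
                         trivIset setT F &
                         \bigcup_i F i = setT]]].

(* Integral of a real function against a signed measure, through its Jordan
   decomposition; the value does not depend on the chosen Hahn
   decomposition. *)
Definition hahn_pos (dd : measure_display) (T : measurableType dd)
    (R : realType) (nu : {charge set T -> \bar R}) : set T :=
  sval (cid (Hahn_decomposition nu)).

Definition hahn_neg (dd : measure_display) (T : measurableType dd)
    (R : realType) (nu : {charge set T -> \bar R}) : set T :=
  sval (cid (svalP (cid (Hahn_decomposition nu)))).

Lemma hahn_posnegP (dd : measure_display) (T : measurableType dd)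
    (R : realType) (nu : {charge set T -> \bar R}) :
  hahn_decomposition nu (hahn_pos nu) (hahn_neg nu).
Proof. exact: svalP (cid (svalP (cid (Hahn_decomposition nu)))). Qed.

Definition charge_int (dd : measure_display) (T : measurableType dd)
    (R : realType) (nu : {charge set T -> \bar R}) (f : T -> R) : R :=
  \int[jordan_pos (hahn_posnegP nu)]_x f x
  - \int[jordan_neg (hahn_posnegP nu)]_x f x.

Definition cm_int (R : realType) (d : nat) (mu : cmeasure R d)
    (f : borelRd R d -> R[i]) : R[i] :=
  (charge_int (cm_re mu) (fun x => complex.Re (f x))
   - charge_int (cm_im mu) (fun x => complex.Im (f x)))
  +i*
  (charge_int (cm_re mu) (fun x => complex.Im (f x))
   + charge_int (cm_im mu) (fun x => complex.Re (f x))).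

Definition dirac_charge (R : realType) (d M : nat) (w : 'I_M -> R)
    (x : 'I_M -> 'rV[R]_d) : {charge set (borelRd R d) -> \bar R} :=
  \big[(fun n1 n2 : {charge set (borelRd R d) -> \bar R} =>
          cadd n1 n2 : {charge set (borelRd R d) -> \bar R})
       / (czero : {charge set (borelRd R d) -> \bar R})]_(j < M)
    (cscale (w j) (charge_of_finite_measure (dirac (x j : borelRd R d)))
       : {charge set (borelRd R d) -> \bar R}).

Lemma dirac_chargeE (R : realType) (d M : nat) (w : 'I_M -> R)
    (x : 'I_M -> 'rV[R]_d) (A : set (borelRd R d)) :
  dirac_charge w x A = (\sum_(j < M) w j * \1_A (x j))%:E.
Proof.
rewrite /dirac_charge (big_morph (fun nu : {charge set _ -> \bar R} => nu A)
  (id1 := 0%E) (op1 := +%E)) //.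
rewrite -sumEFin; apply: eq_bigr => j _.
by rewrite /= /cscale /charge_of_finite_measure /= EFinM.
Qed.

Definition discrete_cm (R : realType) (d M : nat) (a : 'I_M -> R[i])
    (x : 'I_M -> 'rV[R]_d) : cmeasure R d :=
  CMeasure (dirac_charge (fun j => complex.Re (a j)) x)
           (dirac_charge (fun j => complex.Im (a j)) x).

Definition fourier (R : realType) (d : nat) (mu : cmeasure R d)
    (xi : 'rV[R]_d) : R[i] :=
  cm_int mu (fun x => cis (- (2 * pi * dot xi x))).

Definition Phi (R : realType) (d : nat) (Gamma : {fset int})
    (Theta : {fset 'rV[R]_d}) (mu : cmeasure R d) :
    {ffun Gamma * Theta -> R[i]} :=
  [ffun p => fourier mu ((val p.1)%:~R *: val p.2)].

Definition P0_admissible (R : realType) (d : nat) (Gamma : {fset int})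
    (Theta : {fset 'rV[R]_d}) (y : {ffun Gamma * Theta -> R[i]})
    (mu : cmeasure R d) : Prop :=
  supported_in (@half_ball R d) mu /\ Phi Gamma Theta mu = y.

Definition P0_solution (R : realType) (d : nat) (Gamma : {fset int})
    (Theta : {fset 'rV[R]_d}) (y : {ffun Gamma * Theta -> R[i]})
    (mu : cmeasure R d) : Prop :=
  P0_admissible y mu /\
  forall nu, P0_admissible y nu -> (TVnorm mu <= TVnorm nu)%E.

Definition trig_poly (R : realType) (Gamma : {fset int})
    (c : {ffun Gamma -> R[i]}) (t : R) : R[i] :=
  \sum_(k : Gamma) c k * cis (2 * pi * (val k)%:~R * t).

Definition supnorm (R : realType) (p : R -> R[i]) : \bar R :=
  ereal_sup [set (ComplexField.Normc.normc (p t))%:E | t in [set: R]].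

Definition extremal_points (R : realType) (p : R -> R[i]) : set R :=
  [set t | - 2^-1 <= t <= 2^-1 /\ `|p t| = 1].

(* Hermitian positive semidefinite; in R[i], 0 <= z means that z is real and
   nonnegative. *)
Definition psdmx (R : realType) (n : nat) (A : 'M[R[i]]_n) : Prop :=
  A \is hermsymmx /\ forall v : 'cV[R[i]]_n, 0 <= (v ^t* *m A *m v) 0 0.

(* Vectors of C^(2N+1) indexed by {-N,...,N}: position i of a column vector
   carries the frequency i - N. *)
Definition freq (N : nat) (i : 'I_(N.*2.+1)) : int := i%:Z - N%:Z.

Definition freq_pos (N : nat) (k : int) : 'I_(N.*2.+1) :=
  inord (absz (k + N%:Z)).

Lemma freq_posK (N : nat) (k : int) :
  - N%:Z <= k <= N%:Z -> freq (freq_pos N k) = k.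
Proof.
case/andP; rewrite -subr_ge0 opprK => kN kN'.
have e : (absz (k + N%:Z))%:Z = k + N%:Z by rewrite gez0_abs.
rewrite /freq /freq_pos inordK ?e ?addrK //.
by rewrite ltnS -lez_nat e -addnn PoszD lerD2r.
Qed.

Definition restrict_coef (R : realType) (N : nat) (Gamma : {fset int})
    (c : 'cV[R[i]]_(N.*2.+1)) : {ffun Gamma -> R[i]} :=
  [ffun k : Gamma => c (freq_pos N (val k)) 0].

Definition sdp_feasible (R : realType) (N : nat) (Gamma : {fset int})
    (c : 'cV[R[i]]_(N.*2.+1)) (Q : 'M[R[i]]_(N.*2.+1)) : Prop :=
  [/\ Q \is hermsymmx,
      psdmx (block_mx Q c (c ^t* ) (1%:M : 'M[R[i]]_1)),
      forall j : 'I_(N.*2.+1),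
        \sum_(p : 'I_(N.*2.+1) * 'I_(N.*2.+1) | (p.2 == p.1 + j :> nat)%N)
           Q p.1 p.2 = (j == 0 :> nat)%:R
    & forall i, freq i \notin Gamma -> c i 0 = 0].

Definition sdp_objective (R : realType) (N : nat) (Gamma : {fset int})
    (yth : {ffun Gamma -> R[i]}) (c : 'cV[R[i]]_(N.*2.+1)) : R :=
  complex.Re (\sum_(k : Gamma) (restrict_coef Gamma c k)^* * yth k).

Definition sdp_maximizer (R : realType) (N : nat) (Gamma : {fset int})
    (yth : {ffun Gamma -> R[i]}) (c : 'cV[R[i]]_(N.*2.+1)) : Prop :=
  (exists Q, sdp_feasible Gamma c Q) /\
  forall (c' : 'cV[R[i]]_(N.*2.+1)) Q', sdp_feasible Gamma c' Q' ->
    sdp_objective yth c' <= sdp_objective yth c.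

(* A possible outcome of Step 1: one maximizer for each theta.  Maximizers need
   not be unique, so there may be several outcomes. *)
Definition step1_outcome (R : realType) (d N : nat) (Gamma : {fset int})
    (Theta : {fset 'rV[R]_d}) (y : {ffun Gamma * Theta -> R[i]})
    (C : Theta -> 'cV[R[i]]_(N.*2.+1)) : Prop :=
  forall th : Theta, sdp_maximizer [ffun k => y (k, th)] (C th).

Definition tDelta (R : realType) (d : nat) (Gamma : {fset int})
    (Theta : {fset 'rV[R]_d}) (c : Theta -> {ffun Gamma -> R[i]})
    (Theta' : {set Theta}) : set 'rV[R]_d :=
  \bigcap_(th in [set` Theta'])
    \bigcup_(t in extremal_points (trig_poly (c th))) hyperplane (val th) t.

Definition Amap (R : realType) (d : nat) (Gamma : {fset int})
    (Theta : {fset 'rV[R]_d}) (m : nat) (xt : 'I_m -> 'rV[R]_d)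
    (a : {ffun 'I_m -> R[i]}) : {ffun Gamma * Theta -> R[i]} :=
  [ffun p => \sum_(j < m)
     a j * cis (- (2 * pi * (val p.1)%:~R * dot (val p.2) (xt j)))].

(* xt enumerates the (thus finite) set tDelta without repetition, and the
   linear map A is injective. *)
Definition good_enum (R : realType) (d : nat) (Gamma : {fset int})
    (Theta : {fset 'rV[R]_d}) (c : Theta -> {ffun Gamma -> R[i]})
    (Theta' : {set Theta}) (m : nat) (xt : 'I_m -> 'rV[R]_d) : Prop :=
  [/\ injective xt, range xt = tDelta c Theta'
    & injective (Amap Gamma Theta xt)].

(* nu can be returned by Step 2 with the polynomials p_theta of coefficients
   c theta: some subset Theta' of cardinality L' passes all the tests and
   nu = mu_Theta'.  No order of inspection of the subsets is imposed.  The sign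
   test is made where sgn (a_j) is defined; an a_j equal to 0 adds nothing to
   mu_Theta'. *)
Definition step2_returns (R : realType) (d : nat) (Gamma : {fset int})
    (Theta : {fset 'rV[R]_d}) (L' : nat) (y : {ffun Gamma * Theta -> R[i]})
    (c : Theta -> {ffun Gamma -> R[i]}) (nu : cmeasure R d) : Prop :=
  exists (Theta' : {set Theta}) (m : nat) (xt : 'I_m -> 'rV[R]_d)
         (a : {ffun 'I_m -> R[i]}),
    [/\ #|Theta'| = L', good_enum c Theta' xt, Amap Gamma Theta xt a = y,
        forall j, a j != 0 ->
          csgn (a j) = #|Theta'|%:R^-1 *
            \sum_(th in Theta') trig_poly (c th) (dot (xt j) (val th))
      & nu = discrete_cm a xt].

Definition condA1 (R : realType) (d M : nat) (a : 'I_M -> R[i])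
    (x : 'I_M -> 'rV[R]_d) (Gamma : {fset int}) (Theta : {fset 'rV[R]_d})
    (L' : nat) (Theta' : {set Theta}) (c : Theta -> {ffun Gamma -> R[i]}) :
    Prop :=
  #|Theta'| = L' /\
  forall th, th \in Theta' ->
    (supnorm (trig_poly (c th)) <= 1)%E /\
    forall j, trig_poly (c th) (dot (val th) (x j)) = csgn (a j).

Definition condA2 (R : realType) (d : nat) (Gamma : {fset int})
    (Theta : {fset 'rV[R]_d}) (Theta' : {set Theta})
    (c : Theta -> {ffun Gamma -> R[i]}) : Prop :=
  exists (m : nat) (xt : 'I_m -> 'rV[R]_d), good_enum c Theta' xt.

(* Main.v *)
Require Import Defs.
From HB Require Import structures.
From mathcomp Require Import all_boot all_order all_algebra.
From mathcomp Require Import finmap.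
From mathcomp Require Import all_classical all_reals all_analysis.
From mathcomp Require Import measurable_realfun.
From mathcomp Require Import complex polyrcf ring lra zify.
Import Order.TTheory GRing.Theory Num.Theory.
Import numFieldNormedType.Exports.
Local Open Scope classical_set_scope.
Local Open Scope ring_scope.
Local Open Scope complex_scope.

(** Duality drives the proof.  For a direction th the trigonometric polynomial
    p_th gives the function x |-> conj (p_th <th, x>) on R^d.  Its integral
    against a measure nu is a linear combination of the samples Phi nu, so it
    takes the same value on all admissible nu ([cm_int_certificate]).  When
    |p_th| <= 1 its real part is at most the total variation of nu
    ([TVnorm_ge_Re_int]), and when p_th interpolates the signs of the a_j its
    value on mu0 is sum_j |a_j|, the total variation of mu0.  Hence mu0 is a
    solution.  A second solution attains equality for every th in Theta', and
    equality leaves no mass where |p_th <th, .>| < 1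
    ([TVnorm_attained_null]); the second solution, like mu0, is therefore
    carried by the finite set tDelta, and the injectivity of A identifies them
    ([cm_eq_concentrated]).

    The polar decomposition of a complex measure is avoided: a bounded
    measurable function is uniformly close to a function of finitely many
    values, so its integral is close to a finite combination of the masses of
    the cells of a partition ([cm_int_approx]).  Linearity of the integral, its
    value on discrete measures and the duality inequality with its equality
    case all follow from this estimate.

    For Step 1, the semidefinite constraints have to be identified with the
    bound |p| <= 1.  The constraints imply the bound by evaluating the positive
    form at the vector of powers of a point z of the circle.  Conversely, if
    |p| <= 1, then 1 - |p|^2 = |q|^2 for another polynomial q (Fejer-Riesz,
    [fejer_riesz_complement]), and Q = c c^* + q q^* is feasible.  The
    polynomial q is obtained on the real line, where the Cayley transform turns
    1 - |p|^2 into a nonnegative real polynomial, hence into a sum of two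
    squares.  Maximizers exist because the feasible coefficient vectors form a
    compact set, and the c_th of the hypothesis are maximizers by duality.

    For Step 2, let nu, with masses b_j at the points x~_j, be a returned
    measure.  It need not be supported in the ball, so it is not known to be
    admissible, and it is compared with mu0 directly: the sign test makes the
    averaged polynomial a certificate for nu, so the pairings of mu0 with the
    certificates of the L' directions average to sum |b_j|.  Each pairing is at
    most sum |a_j|, which is at most sum |b_j| by the hypothesis on the c_th;
    all these are therefore equalities, every x_j lies in the new finite set
    ([Re_pairing_sum_eq]), and injectivity of A gives nu = mu0. *)

(** The symbol ^* is attached to two convertible conjugations of R[i]; below
    it always means the one of numerical closed fields, about which the
    conjugation lemmas are stated. *)
Local Notation "z ^*" := (Num.conj z) : complex_scope.
Local Notation adj A := (map_mx Num.conj (trmx A)).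
Local Notation normc := ComplexField.Normc.normc.

(** * Nonnegative real polynomials are sums of two squares *)

(** By continuity, a sign condition that may fail at one point extends to it;
    this lets a nonnegative polynomial be divided by a square (x - r)^2. *)
Lemma horner_ge0_punctured {R : rcfType} (p : {poly R}) (r : R) :
  (forall x, x != r -> 0 <= p.[x]) -> forall x, 0 <= p.[x].
Proof.
move=> pge0 x; have [->|/pge0//] := eqVneq x r.
rewrite leNgt; apply/negP => pr0.
have /(poly_cont r p)[d d0 dP] : 0 < - p.[r] by rewrite oppr_gt0.
have ne : r + d / 2 != r by rewrite -subr_eq0 addrAC subrr add0r gt_eqF// divr_gt0.
have := dP (r + d / 2); have := pge0 _ ne.
have -> : r + d / 2 - r = d / 2 by ring.
rewrite ger0_norm ?divr_ge0 ?(ltW d0)// => p1 /(_ _) p2.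
have {}p2 : `|p.[r + d / 2] - p.[r]| < - p.[r] by apply: p2; lra.
by move: p2; rewrite ltr_norml => /andP[]; lra.
Qed.

(** The factor x - r changes sign at r, so p would have to change sign too,
    and therefore vanishes.  In particular real roots of nonnegative
    polynomials have multiplicity at least two. *)
Lemma root_of_sign_change {R : rcfType} (p : {poly R}) (r : R) :
  (forall x, 0 <= (p * ('X - r%:P)).[x]) -> root p r.
Proof.
move=> pge0; apply/negP => /negP; rewrite /root => pr.
have /(poly_cont r p)[d d0 dP] : 0 < `|p.[r]| by rewrite normr_gt0.
have d2 : 0 < d / 2 by rewrite divr_gt0.
have := dP (r + d / 2); have := dP (r - d / 2).
have -> : r + d / 2 - r = d / 2 by ring.
have -> : r - d / 2 - r = - (d / 2) by ring.
rewrite normrN ger0_norm ?(ltW d2)// => /(_ ltac:(lra)) h1 /(_ ltac:(lra)) h2.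
have := pge0 (r + d / 2); have := pge0 (r - d / 2); rewrite !hornerE.
have -> : r + d / 2 - r = d / 2 by ring.
have -> : r - d / 2 - r = - (d / 2) by ring.
rewrite mulrN oppr_ge0 pmulr_lle0// pmulr_lge0// => g1 g2.
move: h1 h2; rewrite !ltr_norml => /andP[h1 h1'] /andP[h2 h2'].
by case: (ltrgt0P p.[r]) h1 h1' h2 h2' pr => // + *; lra.
Qed.

(** A complex root r + i s provides the factor: if s <> 0 its conjugate is
    another root, and if s = 0 the root is double. *)
Lemma nonneg_poly_quadratic_factor {R : rcfType} (p : {poly R}) :
  (forall x, 0 <= p.[x]) -> size p != 1 ->
  exists (r s : R) (q : {poly R}), p = q * (('X - r%:P) ^+ 2 + (s ^+ 2)%:P).
Proof.
move=> pge0 sp.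
have : size (map_poly (real_complex R) p) != 1 by rewrite size_map_poly.
case/closed_rootP=> -[r s] rt.
have [s0|s0] := eqVneq s 0.
  move: rt; rewrite s0 complexr0 (_ : r%:C = real_complex R r)//.
  rewrite fmorph_root => /factor_theorem[q pq].
  have : root q r by apply: root_of_sign_change => x; rewrite -pq.
  case/factor_theorem => q2 q2E; exists r, 0, q2.
  by rewrite pq q2E expr0n/= addr0 -mulrA expr2.
exists r, s; set d := _ + _%:P.
have sd : size d = 3.
  rewrite /d size_polyDl size_exp_XsubC// (leq_ltn_trans (size_polyC_leq1 _))//.
have dr : (map_poly (real_complex R) d).[r +i* s] = 0.
  rewrite rmorphD rmorphXn rmorphB/= map_polyX !map_polyC/= !hornerE/=.
  by rewrite !expr2; simpc; rewrite addNr.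
have dn0 : d != 0 by rewrite -size_poly_gt0 sd.
exists (p %/ d); rewrite {1}(divp_eq p d).
suff -> : p %% d = 0 by rewrite addr0.
have := rt; rewrite {1}(divp_eq p d) rmorphD rmorphM /root hornerD hornerM dr mulr0 add0r.
set m := p %% d => /eqP.
have sm : (size m <= 2)%N by have := ltn_modp p d; rewrite dn0 sd.
have mE : m = (m`_1)%:P * 'X + (m`_0)%:P.
  apply/polyP=> -[|[|i]]; rewrite coefD coefMX !coefC//= ?add0r ?addr0//.
  by rewrite nth_default// (leq_trans sm).
rewrite mE rmorphD rmorphM/= map_polyX !map_polyC/= !hornerE/=; simpc.
move=> /eqP; rewrite eq_complex/= => /andP[/eqP h1 /eqP h2].
have {h2} m1 : m`_1 = 0.
  by move/eqP: h2; rewrite ?addr0 ?add0r mulf_eq0 (negPf s0) orbF => /eqP.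
by move: h1; rewrite m1 mul0r add0r => ->; rewrite !polyC0 mul0r addr0.
Qed.

(** Induction on the degree.  Removing a factor (x - r)^2 + s^2 leaves a
    nonnegative polynomial, and a product of two sums of two squares is again
    one, by the multiplicativity of the norm on the Gaussian integers. *)
Lemma nonneg_poly_sum2sq {R : rcfType} (m : nat) (p : {poly R}) :
  (forall x, 0 <= p.[x]) -> (size p <= m.*2.+1)%N ->
  exists a b : {poly R},
    [/\ (size a <= m.+1)%N, (size b <= m.+1)%N & p = a ^+ 2 + b ^+ 2].
Proof.
have cst (k : nat) (q : {poly R}) : (forall x, 0 <= q.[x]) -> (size q <= 1)%N ->
  exists a b : {poly R},
    [/\ (size a <= k.+1)%N, (size b <= k.+1)%N & q = a ^+ 2 + b ^+ 2].
  move=> q0 /size1_polyC qE; exists (Num.sqrt q`_0)%:P, 0.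
  rewrite size_poly0 (leq_trans (size_polyC_leq1 _))//; split => //.
  rewrite expr0n addr0 -rmorphXn/= sqr_sqrtr//.
  by have := q0 0; rewrite qE hornerC coefC.
elim: m p => [|m IH] p p0 sp; first exact: cst.
have [s1|s1] := leqP (size p) 1; first exact: cst.
have [|r [s [q pE]]] := @nonneg_poly_quadratic_factor _ p p0.
  by rewrite gtn_eqF.
set d := _ + _ in pE.
have sd : size d = 3.
  rewrite /d size_polyDl size_exp_XsubC// (leq_ltn_trans (size_polyC_leq1 _))//.
have q0 : forall x, 0 <= q.[x].
  apply: (@horner_ge0_punctured _ _ r) => x xr.
  have := p0 x; rewrite pE hornerM pmulr_lge0// !hornerE.
  by rewrite ltr_pwDl ?sqr_ge0// exprn_even_gt0//= subr_eq0.
have [|a [b [sa sb qE]]] := IH q q0.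
  have [->|qn0] := eqVneq q 0; first by rewrite size_poly0.
  have dn0 : d != 0 by rewrite -size_poly_gt0 sd.
  by move: sp; rewrite pE size_mul// sd addn3 doubleS.
exists (a * ('X - r%:P) - s%:P * b), (s%:P * a + b * ('X - r%:P)).
have smX (u : {poly R}) : (size u <= m.+1)%N -> (size (u * ('X - r%:P))%R <= m.+2)%N.
  move=> su; rewrite (leq_trans (size_polyMleq _ _))// size_XsubC addn2.
  by rewrite ltnS.
have smC (u : {poly R}) : (size u <= m.+1)%N -> (size (s%:P * u)%R <= m.+2)%N.
  by move=> su; rewrite mul_polyC (leq_trans (size_scale_leq _ _))// leqW.
split.
- by rewrite (leq_trans (size_polyD _ _))// geq_max size_polyN smX// smC.
- by rewrite (leq_trans (size_polyD _ _))// geq_max smX// smC.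
- rewrite pE qE /d rmorphXn/=; ring.
Qed.

(** * Spectral complements on the unit circle *)

(** The polynomial B^m p(A / B): the homogenization of p in degree m, evaluated
    at (A, B). *)
Definition homog {F : fieldType} (m : nat) (p A B : {poly F}) : {poly F} :=
  \sum_(i < m.+1) p`_i *: (A ^+ i * B ^+ (m - i)).

Lemma horner_homog {F : fieldType} (m : nat) (p A B : {poly F}) (x y : F) :
  (size p <= m.+1)%N -> A.[x] = B.[x] * y ->
  (homog m p A B).[x] = B.[x] ^+ m * p.[y].
Proof.
move=> sp e; rewrite (horner_coef_wide _ sp) /homog horner_sum mulr_sumr.
apply: eq_bigr => i _; rewrite hornerZ hornerM !horner_exp e exprMn.
have im : (i <= m)%N by rewrite -ltnS.
have -> : B.[x] ^+ m = B.[x] ^+ i * B.[x] ^+ (m - i) by rewrite -exprD subnKC.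
ring.
Qed.

Lemma size_homog {F : fieldType} (m : nat) (p A B : {poly F}) :
  (size A <= 2)%N -> (size B <= 2)%N -> (size (homog m p A B) <= m.+1)%N.
Proof.
move=> sA sB; apply: (leq_trans (size_sum _ _ _)); apply/bigmax_leqP => i _.
apply: (leq_trans (size_scale_leq _ _)); apply: (leq_trans (size_polyMleq _ _)).
have se (P : {poly F}) k : (size P <= 2)%N -> (size (P ^+ k)%R <= k.+1)%N.
  move=> sP; apply: (leq_trans (size_poly_exp_leq _ _)); rewrite ltnS.
  by rewrite -[leqRHS]mul1n leq_mul2r -subn1 leq_subLR sP orbT.
have im : (i <= m)%N by rewrite -ltnS.
have := leq_add (se _ i sA) (se _ (m - i)%N sB).
by rewrite addSn addnS subnKC// -subn1 leq_subLR add1n.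
Qed.

(** The real parameter u with z = (1 + i u) / (1 - i u); this is the tangent of
    half the argument of z. *)
Definition cayley {R : rcfType} (z : R[i]) : R :=
  complex.Im z / (1 + complex.Re z).

Lemma normc1P {R : rcfType} (z : R[i]) :
  (`|z| == 1) = (complex.Re z ^+ 2 + complex.Im z ^+ 2 == 1).
Proof.
rewrite -(@pexpr_eq1 _ _ 2)// -add_Re2_Im2.
by rewrite -[1]/(real_complex R 1) (inj_eq (@complexI _)).
Qed.

Lemma cayleyP {R : rcfType} (z : R[i]) : `|z| = 1 -> z != -1 ->
  (1 -i* cayley z) * z = 1 +i* cayley z.
Proof.
case: z => a b /eqP; rewrite normc1P /= => /eqP e ne.
have a1 : 1 + a != 0.
  apply: contra ne => /eqP a1; have {}a1 : a = -1 by lra.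
  move: e; rewrite a1 sqrrN expr1n => e.
  have /eqP : b ^+ 2 = 0 by lra.
  by rewrite sqrf_eq0 => /eqP ->; rewrite eq_complex /= oppr0 !eqxx.
rewrite /cayley /=; simpc; apply/eqP; rewrite eq_complex /=; apply/andP.
split; apply/eqP; last by field.
have -> : a + b / (1 + a) * b = (a * (1 + a) + b ^+ 2) / (1 + a) by field.
have -> : a * (1 + a) + b ^+ 2 = 1 + a by rewrite -[in RHS]e; ring.
by rewrite divff.
Qed.

Lemma complex_reim_poly {R : rcfType} (m : nat) (p : {poly R[i]}) (x : R) :
  (size p <= m.+1)%N ->
  p.[x%:C] = (\poly_(i < m.+1) complex.Re p`_i).[x] +i* (\poly_(i < m.+1) complex.Im p`_i).[x].
Proof.
move=> sp; rewrite !horner_poly (horner_coef_wide _ sp).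
elim/big_rec3: _ => [//|i y1 y2 y3 _ ->].
by rewrite -rmorphXn/=; case: (p`_i) => a b; simpc.
Qed.

Lemma sum2sq_normc {R : rcfType} (a b : R) :
  `|a +i* b| ^+ 2 = (a ^+ 2 + b ^+ 2)%:C.
Proof. by rewrite -add_Re2_Im2. Qed.

(** With z = (1 + i u) / (1 - i u), the function (1 + u^2)^m (1 - |p(z)|^2) is a
    real polynomial in u of degree at most 2m, nonnegative on the line, hence
    a^2 + b^2 = |a + i b|^2.  Homogenizing a + i b in degree m, back in the
    variable z, gives q.  The point z = -1 corresponds to u = oo. *)
Lemma fejer_riesz_complement {R : rcfType} (m : nat) (p : {poly R[i]}) :
  (size p <= m.+1)%N -> (forall z, `|z| = 1 -> `|p.[z]| <= 1) ->
  exists2 q : {poly R[i]}, (size q <= m.+1)%N &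
    forall z, `|z| = 1 -> z != -1 -> `|p.[z]| ^+ 2 + `|q.[z]| ^+ 2 = 1.
Proof.
move=> sp p1.
pose al (u : R) : R[i] := 1 +i* u; pose be (u : R) : R[i] := 1 -i* u.
have nal u : `|al u| ^+ 2 = (1 + u ^+ 2)%:C by rewrite sum2sq_normc expr1n.
have nbe u : `|be u| ^+ 2 = (1 + u ^+ 2)%:C by rewrite sum2sq_normc expr1n sqrrN.
have be0 u : be u != 0 by rewrite eq_complex/= oner_eq0.
(* (1 - i u)^m p(z), as a polynomial in u *)
pose w := homog m p (1 + 'i%C *: 'X) (1 - 'i%C *: 'X).
have s1 (s : R[i]) (t : {poly R[i]}) : (size t <= 1)%N ->
    (size (s *: 'X + t)%R <= 2)%N.
  move=> st; rewrite (leq_trans (size_polyD _ _))// geq_max.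
  by rewrite (leq_trans (size_scale_leq _ _)) ?size_polyX// (leq_trans st).
have sw : (size w <= m.+1)%N.
  apply: size_homog; first by rewrite addrC s1// size_poly1.
  by rewrite addrC -scaleNr s1// size_poly1.
have wE (u : R) : w.[u%:C] = be u ^+ m * p.[al u / be u].
  have eb : (1 - 'i%C *: 'X).[u%:C] = be u by rewrite !hornerE/=; simpc.
  rewrite -eb; apply: horner_homog => //; rewrite eb mulrCA divff// mulr1.
  by rewrite !hornerE/=; simpc.
pose wr := \poly_(i < m.+1) complex.Re w`_i.
pose wi := \poly_(i < m.+1) complex.Im w`_i.
pose g : {poly R} := (1 + 'X^2) ^+ m - (wr ^+ 2 + wi ^+ 2).
have gE (u : R) : g.[u]%:C = `|be u ^+ m| ^+ 2 * (1 - `|p.[al u / be u]| ^+ 2).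
  rewrite mulrBr mulr1 -exprMn -normrM -wE (complex_reim_poly _ _ _ sw) sum2sq_normc.
  rewrite normrX exprAC nbe -rmorphXn -rmorphB/=.
  by rewrite /g !hornerE.
have g0 u : 0 <= g.[u].
  rewrite -ler0c gE mulr_ge0 ?exprn_ge0// subr_ge0 exprn_ile1// p1//.
  apply/eqP; rewrite normf_div -(@pexpr_eq1 _ _ 2) ?divr_ge0//.
  by rewrite exprMn exprVn nal nbe divff// -[0]/(real_complex R 0)
      (inj_eq (@complexI _)) gt_eqF// ltr_wpDr// sqr_ge0.
have sg : (size g <= m.*2.+1)%N.
  have sx (t : {poly R}) k : (size t <= k.+1)%N -> forall j, (size (t ^+ j)%R <= (k * j).+1)%N.
    move=> st j; apply: (leq_trans (size_poly_exp_leq _ _)); rewrite ltnS.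
    by rewrite leq_mul2r -subn1 leq_subLR add1n st orbT.
  rewrite /g (leq_trans (size_polyD _ _))// geq_max size_polyN.
  rewrite -mul2n sx/=; last first.
    by rewrite (leq_trans (size_polyD _ _))// geq_max size_poly1 size_polyXn.
  rewrite (leq_trans (size_polyD _ _))// geq_max mulnC !sx//; exact: size_poly.
have [a [b [sa sb gab]]] := nonneg_poly_sum2sq _ _ g0 sg.
pose q0 : {poly R[i]} := map_poly (real_complex R) a + 'i%C *: map_poly (real_complex R) b.
have sq0 : (size q0 <= m.+1)%N.
  rewrite (leq_trans (size_polyD _ _))// geq_max
    (leq_trans (size_scale_leq _ _)) ?size_map_poly//.
  by rewrite sa.
have q0E (u : R) : q0.[u%:C] = a.[u] +i* b.[u].
  rewrite hornerD hornerZ !horner_map/=.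
  by simpc.
(* u = - i (z - 1) / (z + 1), and |z + 1|^2 (1 + u^2) = 4 explains 2^-m *)
pose q := (2 ^- m) *: homog m q0 (- 'i%C *: 'X + 'i%C%:P) ('X + 1).
exists q.
  rewrite (leq_trans (size_scale_leq _ _))// size_homog ?s1 ?size_polyC_leq1//.
  by rewrite -['X]scale1r s1// size_poly1.
move=> z z1 zN1; have cz := cayleyP _ z1 zN1; set u := cayley z in cz.
have zE : z = al u / be u by apply: (mulIf (be0 u)); rewrite divfK// mulrC.
have zu : z - 1 = 'i%C * u%:C * (z + 1).
  move: cz; rewrite (_ : 1 -i* u = 1 - 'i%C * u%:C); last by simpc.
  rewrite (_ : 1 +i* u = 1 + 'i%C * u%:C); last by simpc.
  move/eqP; rewrite -subr_eq0 => /eqP {}cz.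
  by apply/eqP; rewrite -subr_eq0; apply/eqP; rewrite -[RHS]cz; ring.
have qz : q.[z] = 2 ^- m * ((z + 1) ^+ m * q0.[u%:C]).
  have eb : ('X + 1).[z] = z + 1 by rewrite !hornerE.
  have ea : (- 'i%C *: 'X + 'i%C%:P).[z] = ('X + 1).[z] * u%:C.
    transitivity (- 'i%C * z + 'i%C).
      by rewrite hornerD hornerZ hornerX hornerC.
    rewrite eb; have -> : - 'i%C * z + 'i%C = - 'i%C * (z - 1) by ring.
    rewrite zu mulrA mulrA mulNr -expr2 sqr_i opprK mul1r; ring.
  by rewrite /q hornerZ (horner_homog _ _ _ _ _ _ sq0 ea) eb.
have z2 : `|z + 1| ^+ 2 * `|be u| ^+ 2 = 4.
  rewrite -exprMn -normrM zE mulrDl divfK// mul1r.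
  have -> : al u + be u = 2.
    by apply/eqP; rewrite eq_complex /= addrN addr0 !eqxx.
  by rewrite normr_nat -natrX.
rewrite qz q0E !normrM !exprMn sum2sq_normc.
have -> : (a.[u] ^+ 2 + b.[u] ^+ 2)%:C = g.[u]%:C by rewrite gab !hornerE.
rewrite gE -zE.
rewrite !normrX normfV !exprVn normrX.
set t := 1 - _; have -> : `|z + 1| ^+ m ^+ 2 * (`|be u| ^+ m ^+ 2 * t) = 4 ^+ m * t.
  by rewrite mulrA (exprAC _ m 2) (exprAC `|be u| m 2) -exprMn z2.
rewrite normr_nat (exprAC _ m 2) -(natrX _ 2 2) mulKf ?expf_neq0 ?pnatr_eq0//.
by rewrite /t addrC subrK.
Qed.

(** The image of the natural numbers under the Cayley parametrization already
    supplies more points than the degree. *)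
Lemma poly_eq0_circle {R : rcfType} (p : {poly R[i]}) :
  (forall z, `|z| = 1 -> z != -1 -> p.[z] = 0) -> p = 0.
Proof.
move=> p0; apply/eqP; apply: contraT => pn0.
(* the points with Cayley parameter k *)
pose f (k : nat) : R[i] := (1 +i* k%:R) / (1 -i* k%:R).
have be0 (u : R) : 1 -i* u != 0 by rewrite eq_complex/= oner_eq0.
have finj : injective f.
  move=> k l /(congr1 (fun w => w * (1 -i* k%:R) * (1 -i* l%:R))).
  rewrite /f divfK// mulrAC divfK//.
  move/eqP; rewrite eq_complex /= => /andP[_ /eqP kl].
  by apply/eqP; rewrite -(eqr_nat R); apply/eqP; lra.
have f1 k : `|f k| = 1.
  rewrite /f normf_div; apply/eqP; rewrite -(@pexpr_eq1 _ _ 2) ?divr_ge0//.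
  rewrite exprMn exprVn !sum2sq_normc sqrrN divff//.
  by rewrite -[0]/(real_complex R 0) (inj_eq (@complexI _)) gt_eqF// expr1n ltr_wpDr// sqr_ge0.
have fN k : f k != -1.
  apply/eqP => /(congr1 (fun w => w * (1 -i* k%:R))).
  rewrite /f divfK// mulN1r; move/eqP; rewrite eq_complex /= => /andP[/eqP h _].
  by move: h; lra.
have := @max_poly_roots _ p [seq f k | k <- iota 0 (size p)] pn0.
rewrite size_map size_iota ltnn => ->//.
  by apply/allP => _ /mapP[k _ ->]; rewrite /root p0.
by rewrite map_inj_uniq// iota_uniq.
Qed.

(** * The semidefinite constraints as a bound on the unit circle *)

Lemma adjmxM {R : realType} (m n p : nat) (A : 'M[R[i]]_(m, n)) (B : 'M[R[i]]_(n, p)) :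
  (adj (A *m B)) = adj B *m adj A.
Proof. by rewrite trmx_mul map_mxM. Qed.

Lemma adjmxK {R : realType} (m n : nat) (A : 'M[R[i]]_(m, n)) : adj (adj A) = A.
Proof. by apply/matrixP => i j; rewrite !mxE conjCK. Qed.

Lemma hermsymP {R : realType} (n : nat) (A : 'M[R[i]]_n) :
  reflect (adj A = A) (A \is hermsymmx).
Proof. by rewrite qualifE /= expr0 scale1r; apply: (iffP eqP) => /esym. Qed.

Lemma adjmx_self_ge0 {R : realType} (n : nat) (x : 'cV[R[i]]_n) :
  0 <= (adj x *m x) 0 0.
Proof.
rewrite mxE sumr_ge0// => i _; rewrite !mxE mulrC -normCK exprn_ge0//.
Qed.

(** Completion of the square with respect to the last coordinate y. *)
Lemma block_quadratic_form {R : realType} (n : nat) (Q : 'M[R[i]]_n) (c x : 'cV[R[i]]_n)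
    (y : 'M[R[i]]_1) :
  (adj (col_mx x y)) *m block_mx Q c (adj c) 1%:M *m col_mx x y =
  adj x *m Q *m x - adj (adj c *m x) *m (adj c *m x)
  + (adj (adj c *m x + y)) *m (adj c *m x + y).
Proof.
rewrite tr_col_mx map_row_mx mul_row_block mul_row_col mulmx1.
rewrite [(_ + _)^T]raddfD/= map_mxD !adjmxM adjmxK.
rewrite !mulmxDl !mulmxDr !mulmxA.
set a := _ *m x; set b := _ *m _ *m x; set e := _ *m y; set f := _ *m _ *m x.
set g := adj y *m y; rewrite -!addrA; congr (_ + _).
by rewrite addKr addrCA.
Qed.

Lemma psd_block_gram {R : realType} (n : nat) (c q : 'cV[R[i]]_n) :
  psdmx (block_mx (c *m adj c + q *m adj q) c (adj c) (1%:M : 'M[R[i]]_1)).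
Proof.
split.
  apply/hermsymP; rewrite tr_block_mx map_block_mx.
  congr block_mx.
  - by rewrite [(_ + _)^T]raddfD/= map_mxD !adjmxM !adjmxK.
  - exact: adjmxK.
  - by rewrite trmx1 map_mx1.
move=> v; rewrite -[v]vsubmxK block_quadratic_form mxE addr_ge0 ?adjmx_self_ge0//.
rewrite mulmxDr mulmxDl adjmxM adjmxK !mulmxA addrAC subrr add0r.
by rewrite -mulmxA -{1}[q]adjmxK -adjmxM adjmx_self_ge0.
Qed.

(** The completed square vanishes for y = - c^* x, which leaves the Schur
    complement. *)
Lemma psd_block_schur {R : realType} (n : nat) (Q : 'M[R[i]]_n) (c x : 'cV[R[i]]_n) :
  psdmx (block_mx Q c (adj c) (1%:M : 'M[R[i]]_1)) ->
  (adj (adj c *m x) *m (adj c *m x)) 0 0 <= (adj x *m Q *m x) 0 0.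
Proof.
move=> [_ /(_ (col_mx x (- (adj c *m x))))]; rewrite block_quadratic_form subrr mulmx0 addr0.
by rewrite mxE [X in _ + X]mxE subr_ge0.
Qed.

(** The exponents are shifted by N to make them natural numbers; on the unit
    circle this multiplies the trigonometric polynomial by a factor of
    modulus 1. *)
Definition cpoly {R : realType} {N : nat} (c : 'cV[R[i]]_(N.*2.+1)) : {poly R[i]} :=
  \poly_(i < N.*2.+1) c (inord i) 0.

Lemma cpolyE {R : realType} {N : nat} (c : 'cV[R[i]]_(N.*2.+1)) z :
  (cpoly c).[z] = \sum_i c i 0 * z ^+ i.
Proof. by rewrite horner_poly; apply: eq_bigr => i _; rewrite inord_val. Qed.

(** On |z| = 1 the entry (k, k + j) carries the weight conj (z^j), which depends
    on the diagonal j only; the diagonal sums then kill everything but j = 0. *)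
Lemma diag_sum_upper {R : realType} (m : nat) (Q : 'M[R[i]]_m.+1) (z : R[i]) :
  `|z| = 1 ->
  (forall j : 'I_m.+1, \sum_(p : 'I_m.+1 * 'I_m.+1 | (p.2 == p.1 + j :> nat)%N)
           Q p.1 p.2 = (j == 0 :> nat)%:R) ->
  \sum_(p : 'I_m.+1 * 'I_m.+1 | (p.1 <= p.2)%N) z ^+ p.1 * Q p.1 p.2 * (z ^+ p.2)^* = 1.
Proof.
move=> z1 QE.
rewrite (partition_big (fun p : 'I_m.+1 * 'I_m.+1 => inord (p.2 - p.1) : 'I_m.+1) xpredT)//=.
transitivity (\sum_(j : 'I_m.+1) (z ^+ j)^* * (j == 0 :> nat)%:R).
  apply: eq_bigr => j _; rewrite -QE mulr_sumr.
  have lt (p : 'I_m.+1 * 'I_m.+1) : (p.2 - p.1 < m.+1)%N.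
    by rewrite (leq_ltn_trans (leq_subr _ _)).
  apply: eq_big => p.
    rewrite -(inj_eq val_inj)/= inordK//.
    apply/andP/eqP => [[pp /eqP <-]|->]; first by rewrite subnKC.
    by rewrite leq_addr addKn.
  move=> /andP[pp /eqP jE]; have -> : nat_of_ord p.2 = (p.1 + j)%N.
    by rewrite -jE inordK// subnKC.
  rewrite exprD rmorphM mulrACA mulrA [_ * (z ^+ j)^*]mulrC; congr (_ * _).
  have zz : z ^+ p.1 * (z ^+ p.1)^* = 1 by rewrite -normCK normrX z1 !expr1n.
  by rewrite zz mul1r.
rewrite big_ord_recl/= expr0 rmorph1 mul1r big1 ?addr0// => i _.
by rewrite mulr0.
Qed.

(** The entries below the diagonal contribute the conjugate of those strictly
    above it, which is 0 since the diagonal alone already sums to 1. *)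
Lemma diag_sums_quadratic_form {R : realType} (m : nat) (Q : 'M[R[i]]_m.+1) (z : R[i]) :
  `|z| = 1 -> Q \is hermsymmx ->
  (forall j : 'I_m.+1, \sum_(p : 'I_m.+1 * 'I_m.+1 | (p.2 == p.1 + j :> nat)%N)
           Q p.1 p.2 = (j == 0 :> nat)%:R) ->
  \sum_(p : 'I_m.+1 * 'I_m.+1) z ^+ p.1 * Q p.1 p.2 * (z ^+ p.2)^* = 1.
Proof.
move=> z1 /hermsymP Qh QE; have U := diag_sum_upper _ _ _ z1 QE.
rewrite (bigID (fun p : 'I_m.+1 * 'I_m.+1 => (p.1 <= p.2)%N)) /= U.
have -> : \sum_(p : 'I_m.+1 * 'I_m.+1 | ~~ (p.1 <= p.2)%N)
    z ^+ p.1 * Q p.1 p.2 * (z ^+ p.2)^* =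
  (\sum_(p : 'I_m.+1 * 'I_m.+1 | (p.1 < p.2)%N)
    z ^+ p.1 * Q p.1 p.2 * (z ^+ p.2)^*)^*.
  have sw : involutive (fun p : 'I_m.+1 * 'I_m.+1 => (p.2, p.1)) by case.
  rewrite rmorph_sum (reindex_inj (inv_inj sw))/=.
  apply: eq_big => p; first by rewrite -ltnNge.
  move=> _; have -> : Q p.2 p.1 = (Q p.1 p.2)^* by rewrite -[in LHS]Qh !mxE.
  by rewrite !rmorphM/= conjCK mulrC mulrA mulrAC.
have := U; rewrite (bigID (fun p : 'I_m.+1 * 'I_m.+1 => (p.1 < p.2)%N)) /=.
have -> : \sum_(p : 'I_m.+1 * 'I_m.+1 | (p.1 <= p.2)%N && ~~ (p.1 < p.2)%N)
     z ^+ p.1 * Q p.1 p.2 * (z ^+ p.2)^* = 1.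
  rewrite -[RHS](QE ord0); apply: eq_big => p.
    by rewrite -leqNgt addn0 andbC -eqn_leq.
  move=> /andP[p1 p2]; have -> : p.2 = p.1.
    by apply: val_inj; apply/eqP; rewrite eqn_leq p1 leqNgt p2.
  by rewrite mulrAC -normCK normrX z1 !expr1n mul1r.
set S := \sum_(i | _) _; rewrite (_ : \sum_(p | _) _ = S); last first.
  apply: eq_bigl => p; apply/idP/andP => [h|[]//]; split => //; exact: ltnW.
by move=> h; have -> : S = 0; [apply: (addIr 1); rewrite h add0r|rewrite rmorph0 addr0].
Qed.

(** At the vector with entries conj (z^k) the form Q takes the value 1, and the
    form c c^*, which is smaller, the value |p(z)|^2. *)
Lemma sdp_feasible_bound {R : realType} (N : nat) (Gamma : {fset int})
    (c : 'cV[R[i]]_(N.*2.+1)) Q : sdp_feasible Gamma c Q ->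
  forall z, `|z| = 1 -> `|(cpoly c).[z]| <= 1.
Proof.
move=> [Qh Qpsd QE _] z z1.
pose x : 'cV[R[i]]_(N.*2.+1) := \col_i (z ^+ i)^*.
have := psd_block_schur _ _ _ x Qpsd.
have -> : (adj x *m Q *m x) 0 0 = 1.
  rewrite -[RHS](diag_sums_quadratic_form _ _ _ z1 Qh QE) mxE.
  under eq_bigr do rewrite mxE mulr_suml.
  rewrite exchange_big pair_big/=; apply: eq_bigr => p _.
  by rewrite !mxE conjCK.
have -> : adj c *m x = ((cpoly c).[z]^*)%:M.
  apply/matrixP => i j; rewrite !mxE !ord1 mulr1n cpolyE rmorph_sum.
  by apply: eq_bigr => k _; rewrite !mxE -rmorphM.
rewrite tr_scalar_mx map_scalar_mx -scalar_mxM mxE/= conjCK mulr1n -normCK.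
by rewrite expr_le1.
Qed.

(** Take Q = c c^* + q q^* with |p|^2 + |q|^2 = 1 on the circle.  Multiplied by
    z^m, the latter is an identity between polynomials, and its coefficients
    are the diagonal sums of Q. *)
Lemma sdp_feasible_exists {R : realType} (N : nat) (Gamma : {fset int})
    (c : 'cV[R[i]]_(N.*2.+1)) :
  (forall i, freq i \notin Gamma -> c i 0 = 0) ->
  (forall z, `|z| = 1 -> `|(cpoly c).[z]| <= 1) ->
  exists Q, sdp_feasible Gamma c Q.
Proof.
move=> cG c1.
have [q sq qP] := fejer_riesz_complement _ _ (size_poly _ _) c1.
pose qv : 'cV[R[i]]_(N.*2.+1) := \col_i q`_i.
have qvE z : q.[z] = \sum_i qv i 0 * z ^+ i.
  by rewrite (horner_coef_wide _ sq); apply: eq_bigr => i _; rewrite mxE.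
exists (c *m adj c + qv *m adj qv); split => //; last 1 first.
- move=> j.
  set Q := _ + _; set m := N.*2 in c cG c1 sq qP qv qvE Q j *.
  (* (z^k)^* becomes z^(m - k) after multiplication by z^m *)
  pose T : {poly R[i]} :=
    \sum_(p : 'I_m.+1 * 'I_m.+1) Q p.1 p.2 *: 'X^(p.1 + (m - p.2)) - 'X^m.
  have T0 : T = 0.
    apply: poly_eq0_circle => z z1 zN.
    rewrite /T hornerD hornerN horner_sum hornerXn.
    have zz k : z ^+ k * (z ^+ k)^* = 1 by rewrite -normCK normrX z1 !expr1n.
    apply/eqP; rewrite subr_eq0; apply/eqP.
    transitivity (z ^+ m * (`|(cpoly c).[z]| ^+ 2 + `|q.[z]| ^+ 2)); last first.
      by rewrite qP// mulr1.
    have n2 (u : 'cV[R[i]]_m.+1) : `|\sum_i u i 0 * z ^+ i| ^+ 2 =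
       \sum_(p : 'I_m.+1 * 'I_m.+1) (u *m adj u) p.1 p.2 * (z ^+ p.1 * (z ^+ p.2)^*).
      rewrite normCK rmorph_sum mulr_suml.
      under eq_bigr do rewrite mulr_sumr.
      rewrite pair_big/=; apply: eq_bigr => p _.
      by rewrite mxE big_ord1 !mxE rmorphM/= mulrACA.
    rewrite cpolyE qvE !n2 -big_split/= mulr_sumr; apply: eq_bigr => p _.
    rewrite hornerZ hornerXn -mulrDl [Q p.1 p.2]mxE mulrCA; congr (_ * _).
    have pm : (p.2 <= m)%N by rewrite -ltnS.
    have -> : z ^+ m = z ^+ p.2 * z ^+ (m - p.2) by rewrite -exprD subnKC.
    rewrite exprD [RHS](_ : _ = z ^+ p.2 * (z ^+ p.2)^* * (z ^+ p.1 * z ^+ (m - p.2))).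
      by rewrite zz mul1r.
    by rewrite mulrACA [RHS]mulrACA; congr (_ * _); rewrite mulrC.
  have jm : (j <= m)%N by rewrite -ltnS.
  have := congr1 (fun t : {poly R[i]} => t`_(m - j)) T0.
  rewrite /T coefB coef_sum coefXn coef0 => /eqP; rewrite subr_eq0 => /eqP.
  rewrite (_ : (m - j == m)%N = (j == 0 :> nat)); last first.
    by apply/eqP/eqP; lia.
  move=> <-; rewrite big_mkcond/=; apply: eq_bigr => p _.
  have pm : (p.2 <= m)%N by rewrite -ltnS.
  rewrite coefZ coefXn (_ : (m - j == _)%N = (p.2 == p.1 + j :> nat)%N); last first.
    by apply/eqP/eqP; lia.
  by case: ifP; rewrite ?mulr1 ?mulr0.
- by have [/hermsymP] := psd_block_gram _ c qv;
    rewrite tr_block_mx map_block_mx => /eq_block_mx[/hermsymP].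
- exact: psd_block_gram.
Qed.

(** * Trigonometric polynomials and the first step of the algorithm *)

Lemma cisD {R : realType} (s t : R) : cis (s + t) = cis s * cis t.
Proof. by rewrite /cis cosD sinD; simpc; congr (_ +i* _); rewrite addrC. Qed.

Lemma cis0 {R : realType} : cis (0 : R) = 1.
Proof. by rewrite /cis cos0 sin0. Qed.

Lemma cisN {R : realType} (s : R) : cis (- s) = (cis s)^*.
Proof. by rewrite /cis cosN sinN. Qed.

Lemma norm_cis {R : realType} (s : R) : `|cis s| = 1.
Proof. by apply/eqP; rewrite normc1P/= cos2Dsin2. Qed.

Lemma cisX {R : realType} (s : R) n : cis s ^+ n = cis (n%:R * s).
Proof.
elim: n => [|n IH]; first by rewrite expr0 mul0r cis0.
by rewrite exprS IH -cisD -natr1 mulrDl mul1r addrC.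
Qed.

Lemma unit_cis {R : realType} (z : R[i]) : `|z| = 1 -> exists t, z = cis (2 * pi * t).
Proof.
case: z => a b /eqP; rewrite normc1P /= => /eqP ab.
have pi0 : 2 * pi != 0 :> R by rewrite mulf_neq0// gt_eqF// pi_gt0.
suff [s ->] : exists s, a +i* b = cis s by exists (s / (2 * pi)); rewrite mulrCA divff// mulr1.
have a1 : -1 <= a <= 1.
  by rewrite -ler_norml -(@expr_le1 _ 2)// real_normK ?num_real// -ab lerDl sqr_ge0.
have sE : sin (acos a) = `|b|.
  by rewrite sin_acos// -ab addrAC subrr add0r sqrtr_sqr.
have cE : cos (acos a) = a by rewrite acosK// in_itv.
have [b0|b0] := leP 0 b.
  by exists (acos a); rewrite /cis cE sE ger0_norm.
by exists (- acos a); rewrite /cis cosN sinN cE sE ltr0_norm// opprK.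
Qed.

Lemma freqK {N : nat} (i : 'I_(N.*2.+1)) : freq_pos N (freq i) = i.
Proof.
rewrite /freq_pos /freq subrK /=; exact: inord_val.
Qed.

Lemma trig_poly_cpoly {R : realType} (N : nat) (Gamma : {fset int})
    (c : 'cV[R[i]]_(N.*2.+1)) (t : R) :
  (forall k, k \in Gamma -> - N%:Z <= k <= N%:Z) ->
  (forall i, freq i \notin Gamma -> c i 0 = 0) ->
  trig_poly (restrict_coef Gamma c) t =
  cis (- (2 * pi * N%:R * t)) * (cpoly c).[cis (2 * pi * t)].
Proof.
move=> GN cG; rewrite cpolyE mulr_sumr.
rewrite [RHS](bigID (fun i => freq i \in Gamma))/= [X in _ + X]big1 ?addr0; last first.
  by move=> i iG; rewrite cG// mul0r mulr0.
rewrite (reindex_omap (fun k : Gamma => freq_pos N (val k)) (fun i => insub (freq i)))/=; last first.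
  by move=> i iG; rewrite insubT/= freqK.
rewrite /trig_poly; apply: eq_big => [k|k _].
  rewrite freq_posK ?GN ?(valP k)//=.
  by rewrite valK eqxx.
rewrite ffunE mulrCA cisX -cisD; congr (_ * cis _).
rewrite -{1}(@freq_posK N (val k)) ?GN ?(valP k)//.
rewrite /freq rmorphB/= -!pmulrn; ring.
Qed.

Definition extend_coef {R : realType} (N : nat) (Gamma : {fset int})
    (c : {ffun Gamma -> R[i]}) : 'cV[R[i]]_(N.*2.+1) :=
  \col_i (if insub (freq i) is Some k then c k else 0).

Lemma extend_coef0 {R : realType} (N : nat) (Gamma : {fset int})
    (c : {ffun Gamma -> R[i]}) i :
  freq i \notin Gamma -> extend_coef N Gamma c i 0 = 0.
Proof. by move=> h; rewrite mxE insubN. Qed.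

Lemma extend_coefK {R : realType} (N : nat) (Gamma : {fset int})
    (c : {ffun Gamma -> R[i]}) :
  (forall k, k \in Gamma -> - N%:Z <= k <= N%:Z) ->
  restrict_coef Gamma (extend_coef N Gamma c) = c.
Proof.
move=> GN; apply/ffunP => k; rewrite ffunE mxE freq_posK ?GN ?(valP k)//.
by rewrite valK.
Qed.

Lemma sdp_feasible_trig {R : realType} (N : nat) (Gamma : {fset int})
    (c : 'cV[R[i]]_(N.*2.+1)) :
  (forall k, k \in Gamma -> - N%:Z <= k <= N%:Z) ->
  (exists Q, sdp_feasible Gamma c Q) <->
  (forall i, freq i \notin Gamma -> c i 0 = 0) /\
  forall t, `|trig_poly (restrict_coef Gamma c) t| <= 1.
Proof.
move=> GN; split=> [[Q QF]|[cG c1]].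
  have cG : forall i, freq i \notin Gamma -> c i 0 = 0 by case: QF.
  split=> // t; rewrite trig_poly_cpoly// normrM norm_cis mul1r.
  by apply: sdp_feasible_bound QF _ _; exact: norm_cis.
apply: sdp_feasible_exists => // z /unit_cis[t ->].
by have := c1 t; rewrite trig_poly_cpoly// normrM norm_cis mul1r.
Qed.

(** The Schur complement gives |c_k|^2 <= Q_kk, and the trace of Q is 1. *)
Lemma sdp_feasible_coef_le1 {R : realType} (N : nat) (Gamma : {fset int})
    (c : 'cV[R[i]]_(N.*2.+1)) Q : sdp_feasible Gamma c Q ->
  forall i, `|c i 0| <= 1.
Proof.
move=> [_ Qpsd QE _] i.
have QP k : `|c k 0| ^+ 2 <= Q k k.
  have := psd_block_schur _ _ _ (delta_mx k 0) Qpsd.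
  rewrite trmx_delta map_delta_mx -rowE -(colE k (adj c)) -(colE k (row k Q)) !mxE big_ord1 !mxE conjCK.
  by rewrite -normCK.
rewrite -(@expr_le1 _ 2)// (le_trans (QP i))//.
have := QE ord0.
rewrite (reindex_onto (fun k => (k, k)) (fun p => p.1))/=; last first.
  by move=> [p1 p2] /= /eqP; rewrite addn0 => /val_inj ->.
under eq_bigl do rewrite addn0 !eqxx.
move=> tr1; rewrite -[leRHS]tr1 (bigD1 i)//= lerDl sumr_ge0// => k _.
by rewrite (le_trans _ (QP k))// exprn_ge0.
Qed.

Lemma continuous_sumr {R : realType} {T : topologicalType} {I : Type} (r : seq I)
    (F : I -> T -> R) :
  (forall i, continuous (F i)) -> continuous (fun x => \sum_(i <- r) F i x).
Proof.
by move=> Fc; apply: (@continuous_big _ _ _ _ xpredT) => // -[x y]; exact: add_continuous.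
Qed.

Lemma continuous_Re_lincomb {R : realType} (n : nat) (b : 'I_n -> R[i]) :
  continuous (fun u : 'rV[R]_(n + n) =>
    \sum_(i < n) complex.Re ((u 0 (lshift n i) +i* u 0 (rshift n i)) * b i)).
Proof.
apply: continuous_sumr => i u /=; case: (b i) => x y.
have co j : {for u, continuous (fun w : 'rV[R]_(n + n) => w 0 j)}.
  exact: coord_continuous.
suff : {for u, continuous (fun w : 'rV[R]_(n + n) =>
    w 0 (lshift n i) * x - w 0 (rshift n i) * y)} by [].
by apply: continuousB; apply: continuousM;
  [exact: co|exact: cst_continuous|exact: co|exact: cst_continuous].
Qed.

(** The feasible c are the points of a closed subset of a box: a real linear
    functional attains its maximum there.  Compactness is taken in R^(2n), by
    splitting real and imaginary parts. *)
Lemma sdp_maximizer_exists {R : realType} (N : nat) (Gamma : {fset int})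
    (y : {ffun Gamma -> R[i]}) :
  (forall k, k \in Gamma -> - N%:Z <= k <= N%:Z) ->
  exists c : 'cV[R[i]]_(N.*2.+1), sdp_maximizer y c.
Proof.
move=> GN; set n := N.*2.+1.
pose cu (u : 'rV[R]_(n + n)) : 'cV[R[i]]_n :=
  \col_i (u 0 (lshift n i) +i* u 0 (rshift n i)).
pose uc (c : 'cV[R[i]]_n) : 'rV[R]_(n + n) :=
  row_mx (\row_i complex.Re (c i 0)) (\row_i complex.Im (c i 0)).
have ucK c : cu (uc c) = c.
  apply/matrixP => i j; rewrite mxE row_mxEl row_mxEr !mxE !ord1.
  by case: (c i 0).
pose S := [set u | exists Q, sdp_feasible Gamma (cu u) Q].

have SE : S = (\bigcap_(i in [set i | freq i \notin Gamma])
      ([set u : 'rV[R]_(n + n) | u 0 (lshift n i) = 0] `&`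
       [set u : 'rV[R]_(n + n) | u 0 (rshift n i) = 0])) `&`
    \bigcap_(z in [set z : R[i] | `|z| = 1])
      [set u | (complex.Re (cpoly (cu u)).[z]) ^+ 2 +
               (complex.Im (cpoly (cu u)).[z]) ^+ 2 <= 1].
  have le1 (w : R[i]) : (`|w| <= 1) = (complex.Re w ^+ 2 + complex.Im w ^+ 2 <= 1).
    by rewrite -(@expr_le1 _ 2)// -add_Re2_Im2 -[1]/(real_complex R 1) lecR.
  apply/seteqP; split=> u.
    move=> [Q QF]; split.
      move=> i /= iG; have : cu u i 0 = 0 by case: QF => _ _ _ ->.
      by rewrite mxE => /eqP; rewrite eq_complex/= => /andP[/eqP ? /eqP].
    by move=> z /= z1; rewrite -le1; exact: sdp_feasible_bound QF _ z1.
  move=> [u0 u1]; apply: sdp_feasible_exists.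
    by move=> i /u0 [/= h1 h2]; rewrite mxE h1 h2.
  by move=> z /u1 /=; rewrite -le1.
have co j : continuous (fun w : 'rV[R]_(n + n) => w 0 j) by exact: coord_continuous.
have cRe z : continuous (fun u => complex.Re (cpoly (cu u)).[z]).
  rewrite (_ : (fun u => _) = (fun u : 'rV[R]_(n + n) =>
    \sum_(i < n) complex.Re ((u 0 (lshift n i) +i* u 0 (rshift n i)) * z ^+ i))).
    exact: continuous_Re_lincomb.
  by apply/funext => u; rewrite cpolyE raddf_sum; apply: eq_bigr => i _; rewrite mxE.
have cIm z : continuous (fun u => complex.Im (cpoly (cu u)).[z]).
  rewrite (_ : (fun u => _) = (fun u : 'rV[R]_(n + n) =>
    \sum_(i < n) complex.Re ((u 0 (lshift n i) +i* u 0 (rshift n i)) * (- 'i%C * z ^+ i)))).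
    exact: continuous_Re_lincomb.
  apply/funext => u; rewrite cpolyE raddf_sum; apply: eq_bigr => i _; rewrite mxE.
  by case: (z ^+ i) => a b; simpc.
have clS : closed S.
  have cl0 j : closed [set u : 'rV[R]_(n + n) | u 0 j = 0].
    by have /continuous_closedP/(_ _ (@closed_eq _ 0)) := co j.
  rewrite SE; apply: closedI; [apply: closed_bigI => i _|apply: closed_bigI => z _].
    by apply: closedI.
  have cn : continuous (fun u => (complex.Re (cpoly (cu u)).[z]) ^+ 2 +
               (complex.Im (cpoly (cu u)).[z]) ^+ 2).
    under eq_fun do rewrite !expr2.
    move=> u; suff : {for u, continuous (fun u => complex.Re (cpoly (cu u)).[z] *
        complex.Re (cpoly (cu u)).[z] + complex.Im (cpoly (cu u)).[z] *
        complex.Im (cpoly (cu u)).[z])} by [].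
    by apply: continuousD; apply: continuousM; do ?[exact: cRe|exact: cIm].
  by have /continuous_closedP/(_ _ (@closed_le _ 1)) := cn.
have cpS : compact S.
  apply: (@subclosed_compact _ _
    [set v : 'rV[R]_(n + n) | forall j, `[-1, 1]%classic (v ord0 j)]) => //.
    have := @rV_compact R (n + n) (fun=> `[-1, 1]%classic) (fun=> @segment_compact R (-1) 1).
    exact.
  move=> u [Q /sdp_feasible_coef_le1 u1] j /=.
  rewrite in_itv/= -ler_norml -lecR.
  rewrite -(@fintype.splitK n n j); case: (fintype.split j) => k /=;
    rewrite (le_trans _ (u1 k))// mxE.
    exact: (normc_ge_Re (u 0 (lshift n k) +i* u 0 (rshift n k))).
  have := normc_ge_Re ((u 0 (lshift n k) +i* u 0 (rshift n k)) * (- 'i%C)).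
  rewrite normrM normrN (_ : `|'i%C| = 1) ?mulr1; last first.
    by apply/eqP; rewrite normc1P/= expr0n expr1n add0r.
  by simpc.
pose f u := sdp_objective y (cu u).
have cf : continuous f.
  pose b (i : 'I_n) := (if insub (freq i) is Some k then (y k)^* else 0).
  rewrite (_ : f = (fun u : 'rV[R]_(n + n) =>
    \sum_(i < n) complex.Re ((u 0 (lshift n i) +i* u 0 (rshift n i)) * b i))).
    exact: continuous_Re_lincomb.
  apply/funext => u; rewrite /f /sdp_objective raddf_sum.
  rewrite [RHS](bigID (fun i => freq i \in Gamma))/= [X in _ + X]big1 ?addr0; last first.
    by move=> i iG; rewrite /b insubN// mulr0.
  rewrite [RHS](reindex_omap (fun k : Gamma => freq_pos N (val k)) (fun i => insub (freq i)))/=; last first.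
    by move=> i iG; rewrite insubT/= freqK.
  apply: eq_big => [k|k _]; first by rewrite freq_posK ?GN ?(valP k)//= valK eqxx.
  rewrite ffunE !mxE /b freq_posK ?GN ?(valP k)// valK.
  by case: (y k) => p q; simpc.
have S0 : S !=set0.
  exists (uc 0); rewrite /S/= ucK; apply: sdp_feasible_exists => [i _|z _].
    by rewrite mxE.
  by rewrite cpolyE big1 ?normr0// => i _; rewrite mxE mul0r.
have [u uS uM] := EVT_max_rV S0 cpS (continuous_subspaceT cf).
exists (cu u); split; first by have := set_mem uS.
move=> c' Q' F'; have := uM (uc c'); rewrite /f ucK; apply.
by rewrite inE /S/= ucK; exists Q'.
Qed.

(** * Partitions and integrals of step functions *)

Definition measurable_fibers {dd} {T : measurableType dd} {I : Type} (G : T -> I) : Prop :=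
  forall i, measurable (G @^-1` [set i]).

(** The range, contained in [-B, B], is cut into intervals of length e. *)
Lemma real_partition {dd} {T : measurableType dd} {R : realType} (f : T -> R) (B e : R) :
  measurable_fun [set: T] f -> (forall x, `|f x| <= B) -> 0 < e ->
  exists (n : nat) (G : T -> 'I_n) (v : 'I_n -> R),
    measurable_fibers G /\ forall x, `|f x - v (G x)| <= e.
Proof.
move=> mf fB e0.
pose k x := Num.truncn ((f x + B) / e); pose n := Num.truncn ((B + B) / e).
have fB0 x : 0 <= (f x + B) / e.
  by rewrite divr_ge0 ?(ltW e0)//; move: (fB x); rewrite ler_norml => /andP[]; lra.
have kn x : (k x < n.+1)%N.
  rewrite ltnS; apply: le_truncn; rewrite ler_pM2r ?invr_gt0// lerD2r.
  exact: le_trans (ler_norm _) (fB x).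
have kP x : (k x)%:R * e <= f x + B < (k x).+1%:R * e.
  by have := truncn_itv (fB0 x); rewrite ler_pdivlMr// ltr_pdivrMr.
exists n.+1, (fun x => inord (k x)), (fun i => i%:R * e - B); split; last first.
  move=> x; rewrite inordK//; have /andP[h1 h2] := kP x.
  rewrite -natr1 mulrDl mul1r in h2; rewrite ler_norml; apply/andP; split; lra.
move=> i; rewrite (_ : _ @^-1` _ = f @^-1` `[i%:R * e - B, i.+1%:R * e - B[%classic).
  by rewrite -[X in measurable X]setTI; apply: mf.
apply/seteqP; split=> x /=; rewrite in_itv/= lerBlDr ltrBrDr.
  by move=> <-; rewrite inordK.
move=> /andP[h1 h2]; apply: val_inj; rewrite /= inordK//.
rewrite /k; apply: truncn_def.
by rewrite ler_pdivlMr// h1 ltr_pdivrMr.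
Qed.

Lemma normc_norm {R : rcfType} (z : R[i]) : `|z| = (normc z)%:C.
Proof. by []. Qed.

Lemma normc_Re {R : rcfType} (z : R[i]) : `|complex.Re z| <= normc z.
Proof. by have := normc_ge_Re z; rewrite lecR. Qed.

Lemma normc_Im {R : rcfType} (z : R[i]) : `|complex.Im z| <= normc z.
Proof.
case: z => a b; rewrite /= -sqrtr_sqr; by rewrite ler_wsqrtr// lerDr sqr_ge0//.
Qed.

Lemma normc_le_ReIm {R : rcfType} (z : R[i]) :
  normc z <= `|complex.Re z| + `|complex.Im z|.
Proof.
case: z => a b; rewrite /= -[leRHS]ger0_norm ?addr_ge0// -[leRHS]sqrtr_sqr.
rewrite ler_wsqrtr// sqrrD !real_normK ?num_real// lerD2r lerDl.
by rewrite mulrn_wge0// mulr_ge0.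
Qed.

Definition bounded_mfun {dd} {T : measurableType dd} {R : realType} (f : T -> R[i]) : Prop :=
  [/\ measurable_fun [set: T] (fun x => complex.Re (f x)),
      measurable_fun [set: T] (fun x => complex.Im (f x)) &
      exists B, forall x, normc (f x) <= B].

Lemma measurable_fibers_pair {dd} {T : measurableType dd} {I J : Type}
    (G : T -> I) (H : T -> J) :
  measurable_fibers G -> measurable_fibers H ->
  measurable_fibers (fun x => (G x, H x)).
Proof.
move=> mG mH [i j].
rewrite (_ : _ @^-1` _ = (G @^-1` [set i]) `&` (H @^-1` [set j])).
  exact: measurableI.
by apply/seteqP; split=> x /= [-> ->].
Qed.

Lemma complex_partition {dd} {T : measurableType dd} {R : realType} (f : T -> R[i]) (e : R) :
  bounded_mfun f -> 0 < e ->
  exists (I : finType) (G : T -> I) (v : I -> R[i]),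
    measurable_fibers G /\ forall x, normc (f x - v (G x)) <= e.
Proof.
move=> [mr mi [B fB]] e0; have e2 : 0 < e / 2 by rewrite divr_gt0.
have [x|n [G [v [mG Gv]]]] := @real_partition _ _ _ _ B _ mr _ e2.
  exact: le_trans (normc_Re _) (fB x).
have [x|m [H [w [mH Hw]]]] := @real_partition _ _ _ _ B _ mi _ e2.
  exact: le_trans (normc_Im _) (fB x).
exists ('I_n * 'I_m)%type, (fun x => (G x, H x)), (fun p => v p.1 +i* w p.2).
split; first exact: measurable_fibers_pair.
move=> x; apply: (le_trans (normc_le_ReIm _)).
have := Gv x; have := Hw x; case: (f x) => a b /= h1 h2.
by rewrite [leRHS](splitr e) lerD.
Qed.

(** The sum is the integral of the step function v o G, which is within e of f
    everywhere. *)
Lemma Rintegral_step_approx {dd} {T : measurableType dd} {R : realType}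
    (mu : {finite_measure set T -> \bar R}) (I : finType) (G : T -> I) (v : I -> R)
    (f : T -> R) (e : R) :
  measurable_fun [set: T] f -> (exists B, forall x, `|f x| <= B) ->
  measurable_fibers G -> (forall x, `|f x - v (G x)| <= e) ->
  `|\int[mu]_x f x - \sum_i v i * fine (mu (G @^-1` [set i]))| <= e * fine (mu setT).
Proof.
move=> mf [B fB] mG fG.
have muT : (mu setT < +oo)%E by rewrite -ge0_fin_numE// fin_num_measure.
have bint (g : T -> R) (D : R) : measurable_fun [set: T] g -> (forall x, `|g x| <= D) ->
    mu.-integrable setT (EFin \o g).
  move=> mg gD; apply: measurable_bounded_integrable => //.
  by exists D; split; rewrite ?num_real// => M DM x _; exact: le_trans (gD x) (ltW DM).
pose g x := \sum_i v i * \1_(G @^-1` [set i]) x.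
have gE x : g x = v (G x).
  rewrite /g (bigD1 (G x))//= big1 ?addr0.
    by rewrite indicE mem_set ?mulr1.
  by move=> i iG; rewrite indicE memNset ?mulr0//=; apply/eqP; rewrite eq_sym.
have mind i : measurable_fun [set: T] (\1_(G @^-1` [set i]) : T -> R).
  exact: measurable_indic.
have mg : measurable_fun [set: T] g.
  by apply: measurable_sum => i; apply: measurable_funM.
have iind i : mu.-integrable setT (EFin \o (\1_(G @^-1` [set i]) : T -> R)).
  exact: integrable_indic.
have ig : mu.-integrable setT (EFin \o g).
  apply: (bint _ (\sum_i `|v i|)) => // x; rewrite gE (bigD1 (G x))//= lerDl.
  by rewrite sumr_ge0.
have intf : mu.-integrable setT (EFin \o f) by exact: bint fB.
have -> : \sum_i v i * fine (mu (G @^-1` [set i])) = \int[mu]_x g x.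
  rewrite /Rintegral /g.
  under eq_integral do rewrite -sumEFin.
  rewrite integral_sum//; last first.
    move=> i; apply: (bint (fun x => v i * \1_(G @^-1` [set i]) x) `|v i|).
      by apply: measurable_funM.
    by move=> x; rewrite normrM ler_piMr// indicE; case: (_ \in _); rewrite ?normr1 ?normr0.
  rewrite -sum_fine; last first.
    move=> i _; apply: integrable_fin_num => //.
    apply: (bint (fun x => v i * \1_(G @^-1` [set i]) x) `|v i|).
      by apply: measurable_funM.
    by move=> x; rewrite normrM ler_piMr// indicE; case: (_ \in _); rewrite ?normr1 ?normr0.
  apply: eq_bigr => i _.
  have := @RintegralZl _ _ _ mu setT _ (v i) measurableT (iind i).
  rewrite /Rintegral => ->; congr (_ * _).
  by rewrite integral_indic// setIT.
rewrite -RintegralB//; apply: (le_trans (le_normr_Rintegral _ _)) => //.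
  exact: (@integrableB _ _ _ mu setT _ (EFin \o f) (EFin \o g)).
rewrite -Rintegral_cst//; apply: le_Rintegral => //.
- apply: (bint _ e) => [|x]; last by rewrite normr_id gE.
  by apply: measurableT_comp => //; exact: measurable_funB.
- exact: finite_measure_integrable_cst.
- by move=> x _; rewrite gE.
Qed.

(** * Integration against complex measures *)

(** The constant is the total mass of the two Jordan parts; the approximating
    sum involves the charge itself and not its decomposition. *)
Lemma charge_int_approx {dd} {T : measurableType dd} {R : realType}
    (nu : {charge set T -> \bar R}) :
  exists2 C : R, 0 <= C & forall (I : finType) (G : T -> I) (v : I -> R) (f : T -> R) (e : R),
    measurable_fun [set: T] f -> (exists B, forall x, `|f x| <= B) ->
    measurable_fibers G -> (forall x, `|f x - v (G x)| <= e) ->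
    `|charge_int nu f - \sum_i v i * fine (nu (G @^-1` [set i]))| <= e * C.
Proof.
set jp := jordan_pos (hahn_posnegP nu); set jn := jordan_neg (hahn_posnegP nu).
exists (fine (jp setT) + fine (jn setT)); first by rewrite addr_ge0 ?fine_ge0.
move=> I G v f e mf bf mG fG.
have -> : \sum_i v i * fine (nu (G @^-1` [set i])) =
    \sum_i v i * fine (jp (G @^-1` [set i])) - \sum_i v i * fine (jn (G @^-1` [set i])).
  rewrite -sumrB; apply: eq_bigr => i _; rewrite -mulrBr; congr (_ * _).
  rewrite (jordan_decomp (hahn_posnegP nu) (mG i)) /cadd/= /cscale EFinN mulN1e.
  by rewrite fineB//; exact: fin_num_measure.
rewrite mulrDr /charge_int -/jp -/jn opprD addrACA -opprD.
apply: (le_trans (ler_normD _ _)); rewrite normrN lerD//.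
  exact: Rintegral_step_approx.
exact: Rintegral_step_approx.
Qed.

(** This estimate stands in for the theory of integration against complex
    measures: it reduces identities and inequalities between integrals to
    finite sums over a partition. *)
Lemma cm_int_approx {R : realType} {d : nat} (mu : cmeasure R d) :
  exists2 C : R, 0 <= C & forall (I : finType) (G : borelRd R d -> I) (v : I -> R[i])
      (f : borelRd R d -> R[i]) (e : R),
    bounded_mfun f -> measurable_fibers G -> (forall x, normc (f x - v (G x)) <= e) ->
    normc (cm_int mu f - \sum_i v i * cm_val mu (G @^-1` [set i])) <= e * C.
Proof.
have [C1 C10 H1] := charge_int_approx (cm_re mu).
have [C2 C20 H2] := charge_int_approx (cm_im mu).
exists ((C1 + C2) + (C1 + C2)); first by rewrite !addr_ge0.
move=> I G v f e [mr mi [B fB]] mG fG.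
have br : exists B, forall x, `|complex.Re (f x)| <= B.
  by exists B => x; exact: le_trans (normc_Re _) (fB x).
have bi : exists B, forall x, `|complex.Im (f x)| <= B.
  by exists B => x; exact: le_trans (normc_Im _) (fB x).
have vr x : `|complex.Re (f x) - complex.Re (v (G x))| <= e.
  by rewrite -raddfB; exact: le_trans (normc_Re _) (fG x).
have vi x : `|complex.Im (f x) - complex.Im (v (G x))| <= e.
  by rewrite -raddfB; exact: le_trans (normc_Im _) (fG x).
have sE : \sum_i v i * cm_val mu (G @^-1` [set i]) =
   (\sum_i complex.Re (v i) * fine (cm_re mu (G @^-1` [set i])) -
    \sum_i complex.Im (v i) * fine (cm_im mu (G @^-1` [set i]))) +i*
   (\sum_i complex.Im (v i) * fine (cm_re mu (G @^-1` [set i])) +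
    \sum_i complex.Re (v i) * fine (cm_im mu (G @^-1` [set i]))).
  rewrite -sumrB -big_split/=.
  elim/big_rec3: _ => [//|i y1 y2 y3 _ ->].
  by rewrite /cm_val; case: (v i) => a b; simpc; congr (_ +i* (_ + _)); rewrite addrC.
have h1 := H1 _ G (fun i => complex.Re (v i)) _ _ mr br mG vr.
have h2 := H2 _ G (fun i => complex.Im (v i)) _ _ mi bi mG vi.
have h3 := H1 _ G (fun i => complex.Im (v i)) _ _ mi bi mG vi.
have h4 := H2 _ G (fun i => complex.Re (v i)) _ _ mr br mG vr.
rewrite sE /cm_int.
set r1 := charge_int _ _ in h1 *; set r2 := charge_int _ _ in h2 *.
set r3 := charge_int _ _ in h3 *; set r4 := charge_int _ _ in h4 *.
clearbody r1 r2 r3 r4.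
apply: (le_trans (normc_le_ReIm _)); rewrite mulrDr lerD//=.
  rewrite opprD addrACA -opprD mulrDr (le_trans (ler_normD _ _))// normrN lerD//.
by rewrite opprD addrACA mulrDr (le_trans (ler_normD _ _))// lerD.
Qed.

(** The form in which the estimates of [cm_int_approx] are turned into
    identities. *)
Lemma normc_small_eq0 {R : realType} (z : R[i]) (C : R) :
  0 <= C -> (forall e, 0 < e -> normc z <= e * C) -> z = 0.
Proof.
move=> C0 H; apply: ComplexField.Normc.eq0_normc; apply/eqP; rewrite eq_le.
apply/andP; split; last by case: z {H} => a b; exact: sqrtr_ge0.
apply/ler_addgt0Pr => e e0; rewrite add0r.
have C1 : 0 < C + 1 by rewrite ltr_wpDl.
apply: (le_trans (H (e / (C + 1)) _)); first by rewrite divr_gt0.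
by rewrite mulrAC ler_pdivrMr// ler_pM2l// lerDl.
Qed.

Lemma bounded_mfunD {dd} {T : measurableType dd} {R : realType} (f g : T -> R[i]) :
  bounded_mfun f -> bounded_mfun g -> bounded_mfun (fun x => f x + g x).
Proof.
move=> [fr fi [B fB]] [gr gi [D gD]]; split.
- under eq_fun do rewrite raddfD; exact: measurable_funD.
- under eq_fun do rewrite raddfD; exact: measurable_funD.
- exists (B + D) => x; apply: (le_trans (le_normcD _ _)); exact: lerD.
Qed.

Lemma bounded_mfunZ {dd} {T : measurableType dd} {R : realType} (z : R[i]) (f : T -> R[i]) :
  bounded_mfun f -> bounded_mfun (fun x => z * f x).
Proof.
move=> [fr fi [B fB]]; split.
- rewrite (_ : (fun _ => _) = (fun x => complex.Re z * complex.Re (f x) -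
      complex.Im z * complex.Im (f x))).
    by apply: measurable_funB; apply: measurable_funM.
  by apply/funext => x; case: (f x) z => a b [c e].
- rewrite (_ : (fun _ => _) = (fun x => complex.Re z * complex.Im (f x) +
      complex.Im z * complex.Re (f x))).
    by apply: measurable_funD; apply: measurable_funM.
  by apply/funext => x; case: (f x) z => a b [c e].
- exists (normc z * B) => x; rewrite ComplexField.Normc.normcM ler_wpM2l//.
  by case: (z) => a b; exact: sqrtr_ge0.
Qed.

Lemma bounded_mfun0 {dd} {T : measurableType dd} {R : realType} :
  bounded_mfun (fun _ : T => 0 : R[i]).
Proof. by split=> //; exists 0 => x; rewrite ComplexField.Normc.normc0. Qed.

Lemma bounded_mfun_sum {dd} {T : measurableType dd} {R : realType} {J : Type} (r : seq J)
    (f : J -> T -> R[i]) :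
  (forall j, bounded_mfun (f j)) -> bounded_mfun (fun x => \sum_(j <- r) f j x).
Proof.
move=> bf; elim: r => [|j r IH].
  by under eq_fun do rewrite big_nil; exact: bounded_mfun0.
by under eq_fun do rewrite big_cons; exact: bounded_mfunD.
Qed.

Lemma cm_intD {R : realType} {d : nat} (mu : cmeasure R d) (f g : borelRd R d -> R[i]) :
  bounded_mfun f -> bounded_mfun g ->
  cm_int mu (fun x => f x + g x) = cm_int mu f + cm_int mu g.
Proof.
move=> bf bg; have [C C0 H] := cm_int_approx mu.
apply/eqP; rewrite -subr_eq0; apply/eqP.
apply: (@normc_small_eq0 _ _ (C *+ 4)); first by rewrite mulrn_wge0.
move=> e e0.
have [I [G [v [mG Gv]]]] := complex_partition _ _ bf e0.
have [J [K [w [mK Kw]]]] := complex_partition _ _ bg e0.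
have mGK := measurable_fibers_pair _ _ mG mK.
have h1 := H _ _ (fun p => v p.1) _ _ bf mGK Gv.
have h2 := H _ _ (fun p => w p.2) _ _ bg mGK Kw.
have h3 := H _ _ (fun p => v p.1 + w p.2) _ (e + e) (bounded_mfunD _ _ bf bg) mGK.
have {}h3 := h3 (fun x => _).
set a := cm_int _ _ in h1 *; set b := cm_int _ _ in h2 *.
set c := cm_int _ _ in h3 *.
set s := \sum_i _ in h1; set t := \sum_i _ in h2; set u := \sum_i _ in h3.
have uE : u = s + t by rewrite /u -big_split/=; apply: eq_bigr => p _; rewrite mulrDl.
have -> : c - (a + b) = (c - u) + (- (a - s) + - (b - t)) by rewrite uE; ring.
have -> : e * (C *+ 4) = (e + e) * C + (e * C + e * C) by ring.
apply: (le_trans (le_normcD _ _)); rewrite lerD//.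
  apply: h3 => x; rewrite opprD addrACA (le_trans (le_normcD _ _))//.
  by rewrite lerD// ?Gv ?Kw.
by apply: (le_trans (le_normcD _ _)); rewrite lerD// normcN.
Qed.

Lemma normc_ge0 {R : rcfType} (z : R[i]) : 0 <= normc z.
Proof. by case: z => a b; exact: sqrtr_ge0. Qed.

(** The integral is defined through chosen Hahn decompositions; by the
    approximation, it depends on the values on measurable sets alone. *)
Lemma cm_int_ext {R : realType} {d : nat} (mu nu : cmeasure R d)
    (f : borelRd R d -> R[i]) :
  bounded_mfun f -> cm_eq mu nu -> cm_int mu f = cm_int nu f.
Proof.
move=> bf munu; have [C C0 H] := cm_int_approx mu; have [D D0 K] := cm_int_approx nu.
apply/eqP; rewrite -subr_eq0; apply/eqP.
apply: (@normc_small_eq0 _ _ (C + D)); first by rewrite addr_ge0.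
move=> e e0; have [I [G [v [mG Gv]]]] := complex_partition _ _ bf e0.
have h1 := H _ _ _ _ _ bf mG Gv; have h2 := K _ _ _ _ _ bf mG Gv.
have sE : \sum_i v i * cm_val mu (G @^-1` [set i]) =
          \sum_i v i * cm_val nu (G @^-1` [set i]).
  by apply: eq_bigr => i _; rewrite munu.
rewrite sE in h1; set s := \sum_i _ in h1 h2.
rewrite (_ : _ - _ = (cm_int mu f - s) + - (cm_int nu f - s)); last by ring.
by apply: (le_trans (le_normcD _ _)); rewrite mulrDr lerD// normcN.
Qed.

Lemma cm_intZ {R : realType} {d : nat} (mu : cmeasure R d) (z : R[i])
    (f : borelRd R d -> R[i]) :
  bounded_mfun f -> cm_int mu (fun x => z * f x) = z * cm_int mu f.
Proof.
move=> bf; have [C C0 H] := cm_int_approx mu.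
apply/eqP; rewrite -subr_eq0; apply/eqP.
apply: (@normc_small_eq0 _ _ (normc z * C + normc z * C)).
  by rewrite addr_ge0// mulr_ge0// normc_ge0.
move=> e e0; have [I [G [v [mG Gv]]]] := complex_partition _ _ bf e0.
have h1 := H _ _ _ _ _ bf mG Gv.
have h2 := H _ _ (fun i => z * v i) _ (normc z * e) (bounded_mfunZ z _ bf) mG (fun x => _).
have {}h2 : normc (cm_int mu (fun x => z * f x) -
    \sum_i z * v i * cm_val mu (G @^-1` [set i])) <= normc z * e * C.
  by apply: h2 => x; rewrite -mulrBr ComplexField.Normc.normcM ler_wpM2l// normc_ge0.
set s := \sum_i v i * _ in h1.
have sE : \sum_i z * v i * cm_val mu (G @^-1` [set i]) = z * s.
  by rewrite mulr_sumr; apply: eq_bigr => i _; rewrite mulrA.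
rewrite sE in h2.
set a := cm_int _ _ in h2 *; set b := cm_int _ _ in h1 *.
rewrite (_ : _ - _ = (a - z * s) + - (z * (b - s))); last by ring.
apply: (le_trans (le_normcD _ _)).
rewrite normcN ComplexField.Normc.normcM.
have -> : e * (normc z * C + normc z * C) = normc z * e * C + normc z * (e * C) by ring.
by rewrite lerD// ler_wpM2l// normc_ge0.
Qed.

Lemma cm_int_sum {R : realType} {d : nat} (mu : cmeasure R d) {J : Type} (r : seq J)
    (z : J -> R[i]) (f : J -> borelRd R d -> R[i]) :
  (forall j, bounded_mfun (f j)) ->
  cm_int mu (fun x => \sum_(j <- r) z j * f j x) = \sum_(j <- r) z j * cm_int mu (f j).
Proof.
move=> bf; elim: r => [|j r IH].
  under eq_fun do rewrite big_nil; rewrite big_nil.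
  have := cm_intD mu _ _ (@bounded_mfun0 _ (borelRd R d) R) (@bounded_mfun0 _ (borelRd R d) R).
  under eq_fun do rewrite addr0.
  by move=> /eqP; rewrite -subr_eq0 opprD addrA subrr add0r oppr_eq0 => /eqP.
under eq_fun do rewrite big_cons; rewrite big_cons -IH -cm_intZ//.
apply: cm_intD; first exact: bounded_mfunZ.
by apply: bounded_mfun_sum => k; exact: bounded_mfunZ.
Qed.

Lemma cm_val_discrete {R : realType} {d M : nat} (a : 'I_M -> R[i])
    (x : 'I_M -> 'rV[R]_d) (A : set (borelRd R d)) :
  cm_val (discrete_cm a x) A = \sum_(j < M) a j * (\1_A (x j : borelRd R d))%:C.
Proof.
rewrite /cm_val /discrete_cm/= !dirac_chargeE/=.
elim/big_rec3: _ => [//|i y1 y2 y3 _ <-].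
by case: (a i) => b c; simpc.
Qed.

Lemma cm_int_discrete {R : realType} {d M : nat} (a : 'I_M -> R[i])
    (x : 'I_M -> 'rV[R]_d) (f : borelRd R d -> R[i]) :
  bounded_mfun f -> cm_int (discrete_cm a x) f = \sum_(j < M) a j * f (x j).
Proof.
move=> bf; have [C C0 H] := cm_int_approx (discrete_cm a x).
apply/eqP; rewrite -subr_eq0; apply/eqP.
apply: (@normc_small_eq0 _ _ (C + \sum_j normc (a j))).
  by rewrite addr_ge0// sumr_ge0// => j _; exact: normc_ge0.
move=> e e0; have [I [G [v [mG Gv]]]] := complex_partition _ _ bf e0.
have := H _ _ _ _ _ bf mG Gv.
have -> : \sum_i v i * cm_val (discrete_cm a x) (G @^-1` [set i]) =
    \sum_j a j * v (G (x j)).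
  under eq_bigr do rewrite cm_val_discrete mulr_sumr.
  rewrite exchange_big; apply: eq_bigr => j _ /=.
  rewrite (bigD1 (G (x j)))//= big1 ?addr0.
    by rewrite indicE mem_set// mulr1 mulrC.
  by move=> i iG; rewrite indicE memNset ?mulr0//=; apply/eqP; rewrite eq_sym.
move=> h; set s := \sum_j a j * v _ in h.
rewrite (_ : _ - _ = (cm_int (discrete_cm a x) f - s) + (s - \sum_j a j * f (x j))); last by ring.
apply: (le_trans (le_normcD _ _)); rewrite mulrDr lerD//.
rewrite /s -sumrB mulr_sumr.
elim/big_rec2: _ => [|j y1 y2 _ IH]; first by rewrite ComplexField.Normc.normc0.
apply: (le_trans (le_normcD _ _)); rewrite lerD//.
rewrite -mulrBr ComplexField.Normc.normcM mulrC ler_wpM2r ?normc_ge0//.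
by rewrite -normcN opprB.
Qed.

Lemma cm_val0 {R : realType} {d : nat} (mu : cmeasure R d) : cm_val mu set0 = 0.
Proof. by rewrite /cm_val !charge0. Qed.

Lemma cm_valU {R : realType} {d : nat} (mu : cmeasure R d) (A B : set (borelRd R d)) :
  measurable A -> measurable B -> A `&` B = set0 ->
  cm_val mu (A `|` B) = cm_val mu A + cm_val mu B.
Proof.
move=> mA mB AB; rewrite /cm_val !chargeU// !fineD//; exact: fin_num_measure.
Qed.

(** Finite additivity, in the form used for partitions. *)
Lemma cm_val_fibers {R : realType} {d : nat} (mu : cmeasure R d) (I : finType)
    (G : borelRd R d -> I) (P : pred I) :
  measurable_fibers G ->
  measurable [set x | P (G x)] /\
  cm_val mu [set x | P (G x)] = \sum_(i | P i) cm_val mu (G @^-1` [set i]).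
Proof.
move=> mG.
have H (s : seq I) : uniq s -> measurable [set x | G x \in s] /\
    cm_val mu [set x | G x \in s] = \sum_(i <- s) cm_val mu (G @^-1` [set i]).
  elim: s => [_|i s IH /= /andP[iS us]].
    by rewrite (_ : [set _ | _] = set0) ?cm_val0 ?big_nil//; apply/seteqP; split.
  have [m1 m2] := IH us.
  rewrite (_ : [set _ | _] = (G @^-1` [set i]) `|` [set x | G x \in s]); last first.
    apply/seteqP; split=> x /=; rewrite in_cons.
      by case/orP => [/eqP|]; [left|right].
    by case=> [->|xs]; [rewrite eqxx|rewrite xs orbT].
  split; first exact: measurableU.
  rewrite cm_valU ?big_cons ?m2//.
  by apply/seteqP; split=> x //= -[Gx xs]; rewrite Gx (negPf iS) in xs.
have [] := H (enum P) (enum_uniq _); rewrite big_enum/=.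
by rewrite (_ : [set x | G x \in enum P] = [set x | P (G x)])//;
  apply/seteqP; split=> x /=; rewrite mem_enum.
Qed.

Lemma TVnorm_fibers {R : realType} {d : nat} (mu : cmeasure R d) (I : finType)
    (G : borelRd R d -> I) :
  measurable_fibers G ->
  ((\sum_i normc (cm_val mu (G @^-1` [set i])))%:E <= TVnorm mu)%E.
Proof.
move=> mG; pose F k := [set x | nat_of_ord (enum_rank (G x)) = k].
have FE (k : 'I_#|I|) : F k = G @^-1` [set enum_val k].
  apply/seteqP; split=> x /=; rewrite /F/=.
    by move=> /val_inj <-; rewrite enum_rankK.
  by move=> ->; rewrite enum_valK.
apply: (@le_trans _ _ (\sum_(0 <= k <oo) (normc (cm_val mu (F k)))%:E)%E); last first.
  apply: ereal_sup_ubound; exists F => //; split.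
  - move=> k; have [kI|kI] := ltnP k #|I|; first by rewrite (FE (Ordinal kI)).
    rewrite (_ : F k = set0)//; apply/seteqP; split=> x //=; rewrite /F/= => Gk.
    by have := ltn_ord (enum_rank (G x)); rewrite Gk ltnNge kI.
  - by apply/trivIsetP => i j _ _ ij; apply/seteqP; split=> x //= -[Fi Fj];
    move: ij; rewrite -Fi -Fj eqxx.
  - by apply/seteqP; split=> x // _; exists (enum_rank (G x)).
apply: le_trans (nneseries_lim_ge #|I| _); last by move=> k _; rewrite lee_fin normc_ge0.
rewrite sumEFin lee_fin big_mkord.
rewrite [leLHS](reindex _ (onW_bij _ (enum_val_bij I))).
by apply: ler_sum => i _; rewrite FE.
Qed.

(** * Total variation and its dual certificates *)

(** Quantitative form of |int f d mu| <= |mu|: a set A on which |f| stays below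
    1 - dl costs at least dl |mu(A)|.  On a partition on which f varies by less
    than e and which refines {A, ~A}, the approximating sum is bounded by
    (1 + e) times the sum of the |mu(F_i)|, minus dl times those with F_i
    inside A; then e tends to 0. *)
Lemma TVnorm_dual {R : realType} {d : nat} (mu : cmeasure R d)
    (f : borelRd R d -> R[i]) (A : set (borelRd R d)) (dl : R) :
  bounded_mfun f -> (forall x, normc (f x) <= 1) -> measurable A -> 0 <= dl ->
  (forall x, A x -> normc (f x) <= 1 - dl) ->
  ((complex.Re (cm_int mu f) + dl * normc (cm_val mu A))%:E <= TVnorm mu)%E.
Proof.
move=> bf f1 mA dl0 fA; have [C C0 H] := cm_int_approx mu.
(* S is the sum of the |mu(F_i)| over a partition adapted to f, A and e *)
have key e : 0 < e -> exists S : R, (S%:E <= TVnorm mu)%E /\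
    complex.Re (cm_int mu f) + dl * normc (cm_val mu A) <= e * C + (1 + e) * S.
  move=> e0; have [I [G [v [mG Gv]]]] := complex_partition _ _ bf e0.
  have mb : measurable_fibers (fun x => x \in A).
    move=> b; rewrite (_ : _ @^-1` _ = if b then A else ~` A).
      by case: b => //; exact: measurableC.
    case: b; apply/seteqP; split=> x /=.
    - exact: set_mem.
    - exact: mem_set.
    - by move/negbT; rewrite notin_setE.
    - by move=> Ax; apply: memNset.
  have mGA := measurable_fibers_pair _ _ mG mb.
  have := H _ _ (fun p => v p.1) _ _ bf mGA Gv.
  pose F p := (fun x => (G x, x \in A)) @^-1` [set p]; pose m p := normc (cm_val mu (F p)).
  pose S := \sum_p m p; move=> hs; exists S; split; first exact: TVnorm_fibers.
  set s := \sum_i _ in hs.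
  have AS : normc (cm_val mu A) <= \sum_(p | p.2) m p.
    have [_] := @cm_val_fibers _ _ mu _ _ (fun p => p.2) mGA.
    rewrite (_ : [set x | _] = A); last by apply/seteqP; split=> x /=; [exact: set_mem|exact: mem_set].
    move=> ->; elim/big_rec2: _ => [|p y1 y2 _ IH]; first by rewrite ComplexField.Normc.normc0.
    by apply: (le_trans (le_normcD _ _)); rewrite lerD.
  have sS : normc s <= (1 + e) * S - dl * \sum_(p | p.2) m p.
    rewrite [X in _ - _ * X]big_mkcond/= !mulr_sumr -sumrB /s.
    elim/big_rec2: _ => [|p y1 y2 _ IH]; first by rewrite ComplexField.Normc.normc0.
    apply: (le_trans (le_normcD _ _)); rewrite lerD// ComplexField.Normc.normcM -/(F p) -/(m p).
    (* a value v p.1 that is not taken can be large, but its cell has no mass *)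
    have [F0|/set0P[x Fx]] := eqVneq (F p) set0.
      by rewrite /m F0 cm_val0 ComplexField.Normc.normc0; case: ifP; rewrite !mulr0 subrr.
    have v1 : normc (v p.1) <= normc (f x) + e.
      have pE : p.1 = G x by rewrite -Fx.
      rewrite (_ : v p.1 = f x + - (f x - v (G x))); last by rewrite pE; ring.
      by apply: (le_trans (le_normcD _ _)); rewrite lerD// normcN.
    have m0 : 0 <= m p by exact: normc_ge0.
    case: ifP => p2.
      rewrite -mulrBl ler_wpM2r// (le_trans v1)//.
      have /fA : A x by apply: set_mem; move: p2; rewrite -Fx.
      by lra.
    rewrite mulr0 subr0 ler_wpM2r// (le_trans v1)// lerD2r; exact: f1.
  have reS : complex.Re (cm_int mu f) <= e * C + normc s.
    rewrite (le_trans (ler_norm _))// (le_trans (normc_Re _))//.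
    rewrite -[X in normc X](subrK s) (le_trans (le_normcD _ _))// lerD//.
  have := ler_wpM2l dl0 AS; lra.
have [->|] := eqVneq (TVnorm mu) +oo%E; first by rewrite leey.
move: key; case: (TVnorm mu) => [r|//|] key // _; last first.
  by have [S []] := key 1 ltr01.
rewrite lee_fin; apply/ler_addgt0Pr => e e0.
have [|S [Sr h]] := key (e / (C + `|r| + 1)).
  by rewrite divr_gt0// ltr_wpDl// addr_ge0.
rewrite lee_fin in Sr; apply: (le_trans h).
set t := e / _; have t0 : 0 < t by rewrite divr_gt0// ltr_wpDl// addr_ge0.
have tE : t * (C + `|r| + 1) = e by rewrite /t divfK// gt_eqF// ltr_wpDl// addr_ge0.
have rr := ler_norm r.
have : (1 + t) * S <= (1 + t) * r by rewrite ler_wpM2l// addr_ge0// ltW.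
have : t * r <= t * `|r| by rewrite ler_wpM2l// ltW.
by rewrite -tE; lra.
Qed.

Lemma TVnorm_ge_Re_int {R : realType} {d : nat} (mu : cmeasure R d)
    (f : borelRd R d -> R[i]) :
  bounded_mfun f -> (forall x, normc (f x) <= 1) ->
  ((complex.Re (cm_int mu f))%:E <= TVnorm mu)%E.
Proof.
move=> bf f1; have := TVnorm_dual mu f set0 0 bf f1 measurable0 (lexx 0).
by rewrite mul0r addr0; apply.
Qed.

(** A point belongs to at most one cell of a partition, so its mass is counted
    at most once. *)
Lemma TVnorm_discrete {R : realType} {d M : nat} (a : 'I_M -> R[i])
    (x : 'I_M -> 'rV[R]_d) :
  (TVnorm (discrete_cm a x) <= (\sum_j normc (a j))%:E)%E.
Proof.
apply: ge_ereal_sup => _ [F [mF tF _] <-].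
apply: lime_le; first by apply: is_cvg_nneseries => k _ _; rewrite lee_fin normc_ge0.
apply: nearW => n; rewrite sumEFin lee_fin.
apply: (@le_trans _ _ (\sum_(0 <= i < n) \sum_j normc (a j) * \1_(F i) (x j : borelRd R d))).
  apply: ler_sum => i _; rewrite cm_val_discrete.
  elim/big_rec2: _ => [|p y1 y2 _ IH]; first by rewrite ComplexField.Normc.normc0.
  apply: (le_trans (le_normcD _ _)); rewrite lerD// ComplexField.Normc.normcM.
  rewrite ler_wpM2l ?normc_ge0//= expr0n addr0 sqrtr_sqr ger0_norm//.
rewrite exchange_big; apply: ler_sum => j _ /=.
rewrite -mulr_sumr -[leRHS]mulr1 ler_wpM2l ?normc_ge0//.
have [[i Fi]|nF] := pselect (exists i, F i (x j)); last first.
  rewrite big1 ?ler01// => i _; rewrite indicE memNset// => Fi.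
  by apply: nF; exists i.
have other k : k != i -> \1_(F k) (x j : borelRd R d) = 0 :> R.
  move=> ki; rewrite indicE memNset// => Fk.
  have /trivIsetP/(_ k i I I ki) := tF; rewrite -subset0 => /(_ (x j)); exact.
rewrite big_mkord; have [ilt|ige] := ltnP i n.
  rewrite (bigD1 (Ordinal ilt))//= big1 ?addr0; last first.
    move=> k /eqP ki; rewrite other//; apply/eqP => ke.
    by apply: ki; exact: val_inj.
  by rewrite indicE lern1; case: (_ \in _).
rewrite big1 ?ler01// => k _; rewrite other// neq_ltn (leq_trans (ltn_ord k))//.
Qed.

(** Every measurable part of A has measure 0: this is |mu|(A) = 0 without the
    variation measure, whereas mu(A) = 0 alone would allow cancellations. *)
Definition cm_null {R : realType} {d : nat} (mu : cmeasure R d) (A : set 'rV[R]_d) : Prop :=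
  forall B : set (borelRd R d), measurable B -> B `<=` A -> cm_val mu B = 0.

Lemma charge_fine_eq0 {dd} {T : measurableType dd} {R : realType}
    (nu : {charge set T -> \bar R}) A : measurable A -> fine (nu A) = 0 -> nu A = 0%E.
Proof. by move=> mA n0; rewrite -[LHS]fineK ?n0//; exact: fin_num_measure. Qed.

Lemma charge_bigcup_eq0 {dd} {T : measurableType dd} {R : realType}
    (nu : {charge set T -> \bar R}) (F : nat -> set T) :
  (forall n, measurable (F n)) -> trivIset setT F -> (forall n, nu (F n) = 0%E) ->
  nu (\bigcup_n F n) = 0%E.
Proof.
move=> mF tF F0.
have := @charge_semi_sigma_additive _ _ _ nu F mF tF (bigcup_measurable (fun n _ => mF n)).
move/cvg_lim => <-//; apply: lim_near_cst => //; apply: nearW => n.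
by rewrite big1.
Qed.

(** The cells made disjoint remain parts of null sets, so sigma-additivity
    applies. *)
Lemma cm_null_bigcup {R : realType} {d : nat} (mu : cmeasure R d)
    (A : nat -> set (borelRd R d)) :
  (forall n, measurable (A n)) -> (forall n, cm_null mu (A n)) ->
  cm_null mu (\bigcup_n A n).
Proof.
move=> mA nA B mB BA.
have mD n : measurable (B `&` seqDU A n).
  by apply: measurableI => //; apply: seqDU_measurable.
have BE : B = \bigcup_n (B `&` seqDU A n).
  by rewrite -setI_bigcupr -seqDU_bigcup_eq; apply/esym/setIidPl.
have tD : trivIset setT (fun n => B `&` seqDU A n).
  by apply: trivIset_setIl; exact: trivIset_seqDU.
have z n : cm_val mu (B `&` seqDU A n) = 0.
  apply: (nA n) => //; apply: (subset_trans (@subIsetr _ _ _)); exact: subset_seqDU.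
rewrite BE /cm_val !charge_bigcup_eq0//= => n; apply: charge_fine_eq0 => //;
  by have [] := z n.
Qed.

(** The equality case of duality.  The set where |f| < 1 is the union of the sets
    where |f|^2 <= 1 - 1/(n+1), and on each of them |f| <= 1 - dl with dl > 0, so
    that [TVnorm_dual] leaves no room for mass. *)
Lemma TVnorm_attained_null {R : realType} {d : nat} (mu : cmeasure R d)
    (f : borelRd R d -> R[i]) :
  bounded_mfun f -> (forall x, normc (f x) <= 1) ->
  (TVnorm mu <= (complex.Re (cm_int mu f))%:E)%E ->
  cm_null mu [set x | normc (f x) < 1].
Proof.
move=> bf f1 TV.
pose g x : R := complex.Re (f x) ^+ 2 + complex.Im (f x) ^+ 2.
have gE x : normc (f x) = Num.sqrt (g x) by rewrite /g; case: (f x).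
have g0 x : 0 <= g x by rewrite addr_ge0 ?sqr_ge0.
have mg : measurable_fun [set: borelRd R d] g.
  by case: bf => mr mi _; apply: measurable_funD; exact: measurable_funX.
pose A n : set (borelRd R d) := g @^-1` `]-oo, 1 - n.+1%:R^-1]%classic.
have mA n : measurable (A n) by rewrite -[X in measurable X]setTI; exact: mg.
have -> : [set x | normc (f x) < 1] = \bigcup_n A n.
  apply/seteqP; split=> x /=.
    rewrite gE -[ltRHS]sqrtr1 ltr_sqrt// => g1.
    have [n nP] := ltr_add_invr g1; exists n => //.
    by rewrite /A/= in_itv/= lerBrDr ltW.
  move=> [n _]; rewrite /A/= in_itv/= => gn.
  by rewrite gE -[ltRHS]sqrtr1 ltr_sqrt// (le_lt_trans gn)// ltrBlDr ltrDl invr_gt0.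
apply: cm_null_bigcup => // n B mB BA.
pose dl : R := 1 - Num.sqrt (1 - n.+1%:R^-1).
have dl0 : 0 < dl.
  rewrite /dl subr_gt0 -[ltRHS]sqrtr1 ltr_sqrt// ltrBlDr ltrDl invr_gt0//.
have fB x : B x -> normc (f x) <= 1 - dl.
  move=> /BA; rewrite /A/= in_itv/= => gn.
  by rewrite /dl opprB addrC subrK gE ler_wsqrtr.
have := le_trans (TVnorm_dual mu f B dl bf f1 mB (ltW dl0) fB) TV.
rewrite lee_fin gerDl pmulr_rle0// => nB.
by apply: ComplexField.Normc.eq0_normc; apply/eqP; rewrite eq_le nB normc_ge0.
Qed.

Lemma continuous_measurable_borelRd {R : realType} {d : nat} (g : 'rV[R]_d -> R) :
  continuous g -> measurable_fun [set: borelRd R d] (g : borelRd R d -> R).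
Proof.
move=> /continuousP cg; apply: (measurability _ (RGenOpens.measurableE R)).
move=> _ [_ [a [b ->] <-]]; rewrite setTI; apply: sub_sigma_algebra.
exact/cg/interval_open.
Qed.

Lemma bounded_mfun_character {R : realType} {d : nat} (xi : 'rV[R]_d) :
  bounded_mfun (fun x : borelRd R d => cis (- (2 * pi * dot xi x))).
Proof.
have cd : continuous (fun x : 'rV[R]_d => - (2 * pi * dot xi x)).
  rewrite (_ : (fun x => _) = (fun x : 'rV[R]_d => \sum_i (- (2 * pi) * xi 0 i) * x 0 i)).
    apply: continuous_sumr => i x.
    suff : {for x, continuous (fun y : 'rV[R]_d => (- (2 * pi) * xi 0 i) * y 0 i)} by [].
    apply: continuousM; first exact: cst_continuous.
    exact: coord_continuous.
  apply/funext => x; rewrite /dot mulr_sumr -sumrN; apply: eq_bigr => i _; ring.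
split.
- apply: (@continuous_measurable_borelRd _ _ (fun x => cos (- (2 * pi * dot xi x)))) => x.
  apply: continuous_comp; [exact: cd|exact: continuous_cos].
- apply: (@continuous_measurable_borelRd _ _ (fun x => sin (- (2 * pi * dot xi x)))) => x.
  apply: continuous_comp; [exact: cd|exact: continuous_sin].
- by exists 1 => x; have := norm_cis (- (2 * pi * dot xi x)) => /(congr1 (@complex.Re R)) /= ->.
Qed.

(** * Hyperplanes and the points where they meet *)

Lemma dotC {R : realType} {d : nat} (u v : 'rV[R]_d) : dot u v = dot v u.
Proof. by apply: eq_bigr => i _; rewrite mulrC. Qed.

Lemma dotZl {R : realType} {d : nat} (s : R) (u v : 'rV[R]_d) : dot (s *: u) v = s * dot u v.
Proof. by rewrite /dot mulr_sumr; apply: eq_bigr => i _; rewrite mxE mulrA. Qed.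

Lemma dotBl {R : realType} {d : nat} (u w v : 'rV[R]_d) : dot (u - w) v = dot u v - dot w v.
Proof. by rewrite /dot -sumrB; apply: eq_bigr => i _; rewrite !mxE mulrBl. Qed.

Lemma dot_ge0 {R : realType} {d : nat} (u : 'rV[R]_d) : 0 <= dot u u.
Proof. by apply: sumr_ge0 => i _; rewrite -expr2 sqr_ge0. Qed.

Lemma dot_unit {R : realType} {d : nat} (th : 'rV[R]_d) : enorm th = 1 -> dot th th = 1.
Proof. by move=> h; rewrite -[LHS]sqr_sqrtr ?dot_ge0// -/(enorm th) h expr1n. Qed.

(** Cauchy-Schwarz, from 0 <= |x - <th, x> th|^2 = |x|^2 - <th, x>^2. *)
Lemma dot_half_ball {R : realType} {d : nat} (th x : 'rV[R]_d) :
  enorm th = 1 -> half_ball x -> - 2^-1 <= dot th x <= 2^-1.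
Proof.
move=> /dot_unit th1 xb; rewrite -ler_norml -(@ler_pXn2r _ 2)// ?nnegrE//.
rewrite real_normK ?num_real// (@le_trans _ _ (dot x x))//; last first.
  by rewrite -[leLHS]sqr_sqrtr ?dot_ge0// ler_pXn2r// nnegrE// sqrtr_ge0.
have := dot_ge0 (x - dot th x *: th).
rewrite dotBl dotZl (dotC x (x - _)) (dotC th (x - _)) !dotBl !dotZl th1 (dotC x th).
lra.
Qed.

Lemma mem_hyperplane {R : realType} {d : nat} (th x : 'rV[R]_d) :
  enorm th = 1 -> hyperplane th (dot th x) x.
Proof.
move=> /dot_unit th1; exists (x - dot th x *: th); last by rewrite addrC subrK.
by move=> _ [s _ <-]; rewrite dotZl (dotC th (x - _)) dotBl dotZl th1 mulr1 (dotC x) subrr mulr0.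
Qed.

(** A point of the ball is in tDelta as soon as all the polynomials have modulus
    1 there; the ball keeps the parameter <th, x> in the interval on which
    extremal points are searched. *)
Lemma mem_tDelta {R : realType} {d : nat} (Gamma : {fset int})
    (Theta : {fset 'rV[R]_d}) (c : Theta -> {ffun Gamma -> R[i]})
    (Theta' : {set Theta}) (x : 'rV[R]_d) :
  (forall th, th \in Theta -> enorm th = 1) -> half_ball x ->
  (forall th, th \in Theta' -> `|trig_poly (c th) (dot (val th) x)| = 1) ->
  tDelta c Theta' x.
Proof.
move=> Th1 xb p1 th thT; have e1 := Th1 _ (valP th).
exists (dot (val th) x); last exact: mem_hyperplane.
by split; [exact: dot_half_ball|exact: p1].
Qed.

Lemma rV_not_enumerable {R : realType} {d m : nat} (xt : 'I_m -> 'rV[R]_d) :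
  (0 < d)%N -> range xt <> setT.
Proof.
case: d xt => // d xt _ xtT.
have h (k : 'I_m.+1) : exists j, xt j = const_mx (k : nat)%:R.
  have : range xt (const_mx (k : nat)%:R) by rewrite xtT.
  by move=> [j _ jE]; exists j.
pose g k := projT1 (cid (h k)).
have gE k : xt (g k) = const_mx (k : nat)%:R by exact: projT2 (cid (h k)).
have ginj : injective g.
  move=> k l kl; have := gE k; rewrite kl gE => /matrixP/(_ 0 0); rewrite !mxE.
  by move/eqP; rewrite eqr_nat => /eqP lk; apply: val_inj.
by have := leq_card g ginj; rewrite !card_ord ltnn.
Qed.

(** An empty intersection is the whole space, which is infinite. *)
Lemma Theta'_nonempty {R : realType} {d : nat} (Gamma : {fset int})
    (Theta : {fset 'rV[R]_d}) (c : Theta -> {ffun Gamma -> R[i]})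
    (Theta' : {set Theta}) (m : nat) (xt : 'I_m -> 'rV[R]_d) :
  (0 < d)%N -> range xt = tDelta c Theta' -> exists th, th \in Theta'.
Proof.
move=> d0 xtE; apply/set0Pn; apply/eqP => T0.
apply: (rV_not_enumerable xt d0); rewrite xtE /tDelta T0.
by apply/seteqP; split=> // x _ th /=; rewrite inE.
Qed.

(** * Certificates built from trigonometric polynomials *)

Lemma supnorm_le1 {R : realType} (p : R -> R[i]) :
  (supnorm p <= 1)%E <-> forall t, `|p t| <= 1.
Proof.
split=> [h t|h].
  rewrite normc_norm -[1]/(real_complex R 1) lecR -lee_fin (le_trans _ h)//.
  by apply: ereal_sup_ubound; exists t.
apply: ge_ereal_sup => _ [t _ <-]; rewrite lee_fin -lecR -normc_norm; exact: h.
Qed.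

Lemma normc_csgn {R : rcfType} (a : R[i]) : a != 0 -> `|a / `|a| | = 1.
Proof. by move=> a0; rewrite normf_div normr_id divff// normr_eq0. Qed.

Lemma mul_csgn_conj {R : realType} (a : R[i]) : a != 0 -> a * (csgn a)^* = `|a|.
Proof.
move=> a0; rewrite /csgn rmorphM fmorphV/= mulrA -normCK geC0_conj// expr2 mulfK//.
by rewrite normr_eq0.
Qed.

(** The conjugate makes this function pair with a measure through its Fourier
    samples with negative exponents, as in the objective of Step 1. *)
Definition certificate {R : realType} {d : nat} {Gamma : {fset int}}
    (c : {ffun Gamma -> R[i]}) (th : 'rV[R]_d) (x : borelRd R d) : R[i] :=
  (trig_poly c (dot th x))^*.

Lemma certificateE {R : realType} {d : nat} {Gamma : {fset int}}
    (c : {ffun Gamma -> R[i]}) (th : 'rV[R]_d) :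
  certificate c th = (fun x => \sum_(k : Gamma) (c k)^* *
     cis (- (2 * pi * dot ((val k)%:~R *: th) x))).
Proof.
apply/funext => x; rewrite /certificate /trig_poly rmorph_sum; apply: eq_bigr => k _.
by rewrite rmorphM/= -cisN dotZl mulrA.
Qed.

Lemma bounded_mfun_certificate {R : realType} {d : nat} {Gamma : {fset int}}
    (c : {ffun Gamma -> R[i]}) (th : 'rV[R]_d) : bounded_mfun (certificate c th).
Proof.
rewrite certificateE; apply: bounded_mfun_sum => k; apply: bounded_mfunZ.
exact: bounded_mfun_character.
Qed.

(** The pairing only sees the samples of the measure: measures with the same
    data pair equally with every certificate. *)
Lemma cm_int_certificate {R : realType} {d : nat} {Gamma : {fset int}}
    {Theta : {fset 'rV[R]_d}} (c : {ffun Gamma -> R[i]}) (th : Theta) (mu : cmeasure R d) :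
  cm_int mu (certificate c (val th)) = \sum_(k : Gamma) (c k)^* * Phi Gamma Theta mu (k, th).
Proof.
rewrite certificateE cm_int_sum; last by move=> k; exact: bounded_mfun_character.
by apply: eq_bigr => k _; rewrite ffunE.
Qed.

Lemma normc_certificate {R : realType} {d : nat} {Gamma : {fset int}}
    (c : {ffun Gamma -> R[i]}) (th : 'rV[R]_d) x :
  (normc (certificate c th x))%:C = `|trig_poly c (dot th x)|.
Proof. by rewrite -normc_norm norm_conjC. Qed.

Lemma Phi_discrete {R : realType} {d m : nat} (Gamma : {fset int})
    (Theta : {fset 'rV[R]_d}) (a : 'I_m -> R[i]) (x : 'I_m -> 'rV[R]_d) :
  Phi Gamma Theta (discrete_cm a x) = Amap Gamma Theta x [ffun j => a j].
Proof.
apply/ffunP => p; rewrite !ffunE /fourier cm_int_discrete; last exact: bounded_mfun_character.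
by apply: eq_bigr => j _; rewrite ffunE dotZl mulrA.
Qed.

Lemma Phi_ext {R : realType} {d : nat} (Gamma : {fset int})
    (Theta : {fset 'rV[R]_d}) (mu nu : cmeasure R d) :
  cm_eq mu nu -> Phi Gamma Theta mu = Phi Gamma Theta nu.
Proof.
move=> e; apply/ffunP => p; rewrite !ffunE; apply: cm_int_ext => //.
exact: bounded_mfun_character.
Qed.

(** * Measures carried by finitely many points *)

Lemma measurable_point {R : realType} {d : nat} (x : 'rV[R]_d) :
  measurable ([set x] : set (borelRd R d)).
Proof.
rewrite (_ : [set x] = \bigcap_(i in [set: 'I_d]) ((fun y : borelRd R d => y 0 i) @^-1` [set x 0 i])).
  apply: fin_bigcap_measurable => // i _; rewrite -[X in measurable X]setTI.
  apply: (@continuous_measurable_borelRd R d (fun y => y 0 i)) => //.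
  exact: coord_continuous.
apply/seteqP; split=> [y -> //|y yx]; apply/matrixP => i j; rewrite ord1.
exact: yx.
Qed.

Definition point_masses {R : realType} {d m : nat} (nu : cmeasure R d)
    (xt : 'I_m -> 'rV[R]_d) : 'I_m -> R[i] := fun j => cm_val nu [set xt j].

(** The points are removed from A one at a time, and what remains at the end is
    part of a null set. *)
Lemma concentrated_discrete {R : realType} {d m : nat} (nu : cmeasure R d)
    (xt : 'I_m -> 'rV[R]_d) :
  injective xt -> cm_null nu (~` range xt) ->
  cm_eq nu (discrete_cm (point_masses nu xt) xt).
Proof.
move=> xti n0 A mA; rewrite cm_val_discrete.
pose D (s : seq 'I_m) : set (borelRd R d) := A `\` [set x | exists2 j, j \in s & xt j = x].
have H s : uniq s -> measurable (D s) /\ cm_val nu A = cm_val nu (D s) +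
    \sum_(j <- s) point_masses nu xt j * (\1_A (xt j : borelRd R d))%:C.
  elim: s => [_|j s IH /= /andP[js us]].
    rewrite big_nil addr0 (_ : D [::] = A)//.
    by apply/seteqP; split=> x; [case|move=> Ax; split=> //= -[]].
  have [mD ->] := IH us.
  have DE : D s = D (j :: s) `|` (if xt j \in A then [set xt j] else set0).
    apply/seteqP; split=> x /=.
      move=> [Ax nx]; have [xj|xj] := eqVneq x (xt j).
        by right; rewrite -xj mem_set.
      left; split=> //= -[k]; rewrite in_cons => /orP[/eqP ->|ks] kx.
        by rewrite kx eqxx in xj.
      by apply: nx; exists k.
    case=> [[Ax nx]|].
      by split=> // -[k ks kx]; apply: nx; exists k => //=; rewrite in_cons ks orbT.
    case: ifPn => // /set_mem Axj /= ->; split=> // -[k ks /xti kj].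
    by rewrite kj (negPf js) in ks.
  have mD' : measurable (D (j :: s)).
    rewrite (_ : D _ = D s `\` [set xt j]); first by apply: measurableD => //; exact: measurable_point.
    apply/seteqP; split=> x.
      move=> [Ax nx]; split; first (split=> // -[k ks kx];
        by apply: nx; exists k => //=; rewrite in_cons ks orbT).
      by move=> /= xj; apply: nx; exists j; rewrite //= mem_head.
    move=> [[Ax nx] xj]; split=> // -[k]; rewrite /= in_cons => /orP[/eqP ->|ks] kx.
      by apply: xj.
    by apply: nx; exists k.
  split=> //; rewrite DE cm_valU//; last 2 first.
  - by case: ifP => // _; exact: measurable_point.
  - apply/seteqP; split=> x //= -[[Ax nx]]; case: ifP => // _ /= xj; apply: nx.
    by exists j; rewrite //= mem_head.
  rewrite big_cons -addrA; congr (_ + (_ + _)).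
  rewrite indicE /point_masses; case: ifP => _; first by rewrite mulr1.
  by rewrite cm_val0 mulr0.
have [mD ->] := H (enum 'I_m) (enum_uniq _).
rewrite n0//; last first.
  by move=> x [Ax nx] /= [j _ jx]; apply: nx; exists j => //; rewrite mem_enum.
by rewrite add0r big_enum.
Qed.

(** On measures carried by the points xt, the operator Phi is the map A applied
    to the masses. *)
Lemma cm_eq_concentrated {R : realType} {d m : nat} (Gamma : {fset int})
    (Theta : {fset 'rV[R]_d}) (xt : 'I_m -> 'rV[R]_d) (mu nu : cmeasure R d) :
  injective xt -> injective (Amap Gamma Theta xt) ->
  cm_null mu (~` range xt) -> cm_null nu (~` range xt) ->
  Phi Gamma Theta mu = Phi Gamma Theta nu -> cm_eq mu nu.
Proof.
move=> xti Ai nmu nnu Pmn.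
have Emu := concentrated_discrete _ _ xti nmu.
have Enu := concentrated_discrete _ _ xti nnu.
move=> A mA; rewrite Emu// Enu// !cm_val_discrete; apply: eq_bigr => j _.
have : Amap Gamma Theta xt [ffun j => point_masses mu xt j] =
       Amap Gamma Theta xt [ffun j => point_masses nu xt j].
  by rewrite -!Phi_discrete -(Phi_ext _ _ _ _ Emu) -(Phi_ext _ _ _ _ Enu).
by move/Ai/ffunP/(_ j); rewrite !ffunE => ->.
Qed.

Lemma cm_null_discrete {R : realType} {d m M : nat} (a : 'I_M -> R[i])
    (x : 'I_M -> 'rV[R]_d) (S : set 'rV[R]_d) :
  (forall j, S (x j)) -> cm_null (discrete_cm a x) (~` S).
Proof.
move=> xS B mB BS; rewrite cm_val_discrete big1// => j _.
by rewrite indicE memNset ?mulr0// => /BS; apply.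
Qed.

(** * Equality in the duality inequality *)

Lemma Re_pairing_le {R : realType} (a q : R[i]) :
  `|q| <= 1 -> complex.Re (a * q^*) <= normc a.
Proof.
move=> q1; rewrite (le_trans (ler_norm _))// (le_trans (normc_Re _))//.
rewrite ComplexField.Normc.normcM ler_piMr ?normc_ge0//.
by rewrite -lecR -normc_norm norm_conjC.
Qed.

Lemma Re_pairing_eq {R : realType} (a q : R[i]) :
  a != 0 -> `|q| <= 1 -> normc a <= complex.Re (a * q^*) -> `|q| = 1.
Proof.
move=> a0 q1 h; apply/eqP; rewrite eq_le q1/=.
have : normc a <= normc a * normc (q^*).
  rewrite -ComplexField.Normc.normcM (le_trans h)// (le_trans (ler_norm _))//.
  exact: normc_Re.
have a1 : 0 < normc a.
  rewrite lt_def normc_ge0 andbT; apply: contra a0 => /eqP/ComplexField.Normc.eq0_normc ->//.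
by rewrite ler_pMr// -lecR -normc_norm norm_conjC.
Qed.

(** Each term is at most |a_j|, so equality of the sums forces equality of the
    terms, and then |q_j| cannot be less than 1. *)
Lemma Re_pairing_sum_eq {R : realType} {M : nat} (a q : 'I_M -> R[i]) :
  (forall j, a j != 0) -> (forall j, `|q j| <= 1) ->
  \sum_j normc (a j) <= complex.Re (\sum_j a j * (q j)^*) -> forall j, `|q j| = 1.
Proof.
move=> a0 q1; rewrite raddf_sum => h j; apply: (Re_pairing_eq (a j)) => //.
move: h; rewrite (bigD1 j)//= [leRHS](bigD1 j)//= => h.
have : \sum_(i < M | i != j) complex.Re (a i * (q i)^*) <= \sum_(i < M | i != j) normc (a i).
  by apply: ler_sum => i _; exact: Re_pairing_le.
by move=> h2; rewrite -(lerD2r (\sum_(i < M | i != j) normc (a i))) (le_trans h)// lerD2l.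
Qed.

Lemma cm_int_certificate_discrete {R : realType} {d M : nat} {Gamma : {fset int}}
    (c : {ffun Gamma -> R[i]}) (th : 'rV[R]_d) (a : 'I_M -> R[i]) (x : 'I_M -> 'rV[R]_d) :
  cm_int (discrete_cm a x) (certificate c th) =
  \sum_j a j * (trig_poly c (dot th (x j)))^*.
Proof. by rewrite cm_int_discrete//; exact: bounded_mfun_certificate. Qed.

Lemma cm_int_certificate_sign {R : realType} {d M : nat} {Gamma : {fset int}}
    (c : {ffun Gamma -> R[i]}) (th : 'rV[R]_d) (a : 'I_M -> R[i]) (x : 'I_M -> 'rV[R]_d) :
  (forall j, a j != 0) -> (forall j, trig_poly c (dot th (x j)) = csgn (a j)) ->
  complex.Re (cm_int (discrete_cm a x) (certificate c th)) = \sum_j normc (a j).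
Proof.
move=> a0 pj; rewrite cm_int_certificate_discrete raddf_sum; apply: eq_bigr => j _.
by rewrite pj mul_csgn_conj.
Qed.

Lemma certificate_le1 {R : realType} {d : nat} {Gamma : {fset int}}
    (c : {ffun Gamma -> R[i]}) (th : 'rV[R]_d) :
  (forall t, `|trig_poly c t| <= 1) -> forall x, normc (certificate c th x) <= 1.
Proof. by move=> c1 x; rewrite -lecR normc_certificate. Qed.

Lemma cm_int_certificate_ext {R : realType} {d : nat} {Gamma : {fset int}}
    {Theta : {fset 'rV[R]_d}} (c : {ffun Gamma -> R[i]}) (th : Theta) (mu nu : cmeasure R d) :
  Phi Gamma Theta mu = Phi Gamma Theta nu ->
  cm_int mu (certificate c (val th)) = cm_int nu (certificate c (val th)).
Proof. by move=> e; rewrite !cm_int_certificate e. Qed.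

(** Outside the null set where some |p_th| < 1, a point of the ball is in tDelta;
    so a set that avoids tDelta is, up to null sets, disjoint from the
    ball. *)
Lemma minimizer_concentrated {R : realType} {d m : nat} (Gamma : {fset int})
    (Theta : {fset 'rV[R]_d}) (c : Theta -> {ffun Gamma -> R[i]})
    (Theta' : {set Theta}) (xt : 'I_m -> 'rV[R]_d) (nu : cmeasure R d) :
  (forall th, th \in Theta -> enorm th = 1) ->
  (exists th, th \in Theta') ->
  range xt = tDelta c Theta' ->
  supported_in (@half_ball R d) nu ->
  (forall th, th \in Theta' -> forall t, `|trig_poly (c th) t| <= 1) ->
  (forall th, th \in Theta' ->
     (TVnorm nu <= (complex.Re (cm_int nu (certificate (c th) (val th))))%:E)%E) ->
  cm_null nu (~` range xt).
Proof.
move=> Th1 [th0 th0T] xtE sup c1 TV.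
(* the default th0 lies in Theta', so every index n denotes a direction of Theta' *)
pose f n := let th := nth th0 (enum Theta') n in certificate (c th) (val th).
have thT n : nth th0 (enum Theta') n \in Theta'.
  have [nT|nT] := ltnP n (size (enum Theta')); last by rewrite nth_default.
  by rewrite -mem_enum mem_nth.
pose U n : set (borelRd R d) := [set x | normc (f n x) < 1].
have mU n : measurable (U n).
  pose th := nth th0 (enum Theta') n.
  have [mr mi _] := bounded_mfun_certificate (c th) (val th).
  pose g x : R := complex.Re (f n x) ^+ 2 + complex.Im (f n x) ^+ 2.
  have mg : measurable_fun [set: borelRd R d] g.
    by apply: measurable_funD; exact: measurable_funX.
  rewrite (_ : U n = g @^-1` `]-oo, 1[%classic).
    by rewrite -[X in measurable X]setTI; exact: mg.
  apply/seteqP; split=> x; rewrite /U /g/= in_itv/=; case: (f n x) => p q /=.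
    by rewrite -[ltRHS]sqrtr1 ltr_sqrt.
  by rewrite -[X in _ -> _ < X]sqrtr1 ltr_sqrt.
have nU : cm_null nu (\bigcup_n U n).
  apply: cm_null_bigcup => // n; apply: TVnorm_attained_null.
  - exact: bounded_mfun_certificate.
  - by apply: certificate_le1; exact: c1.
  - exact: TV.
move=> B mB BX.
have mbU : measurable (\bigcup_n U n) by exact: bigcup_measurable.
rewrite -(setDUK (@subIsetl _ B (\bigcup_n U n))) setDIr setDv set0U.
rewrite cm_valU; last 3 first.
- exact: measurableI.
- exact: measurableD.
- by rewrite setIDA setDE -setIA -setIA (setIC _ (~` _)) (setIA _ (~` _)) setICr set0I setI0.
rewrite (nU (B `&` _)); [|exact: measurableI|exact: subIsetr].
rewrite add0r; apply: sup; first exact: measurableD.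
apply/seteqP; split=> x //= [[Bx nUx] xb].
apply: (BX x Bx); rewrite xtE; apply: mem_tDelta => // th thT'.
apply/eqP; rewrite eq_le c1//=.
have nE : nth th0 (enum Theta') (index th (enum Theta')) = th.
  by rewrite nth_index// mem_enum.
rewrite -normc_certificate -[1]/(real_complex R 1) lecR leNgt; apply/negP => h.
by apply: nUx; exists (index th (enum Theta')) => //; rewrite /U/= /f/= nE.
Qed.

(** * Recovery of the discrete measure *)

Lemma sdp_objective_certificate {R : realType} {d N : nat} {Gamma : {fset int}}
    {Theta : {fset 'rV[R]_d}} (mu : cmeasure R d) (th : Theta) (c : 'cV[R[i]]_(N.*2.+1)) :
  sdp_objective [ffun k => Phi Gamma Theta mu (k, th)] c =
  complex.Re (cm_int mu (certificate (restrict_coef Gamma c) (val th))).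
Proof.
rewrite cm_int_certificate /sdp_objective; congr complex.Re.
by apply: eq_bigr => k _; rewrite [X in _ * X = _]ffunE.
Qed.

Section Recovery.
Context {R : realType} {d M N L' : nat} (a : 'I_M -> R[i]) (x : 'I_M -> 'rV[R]_d)
  (Gamma : {fset int}) (Theta : {fset 'rV[R]_d})
  (Theta' : {set Theta}) (c : Theta -> {ffun Gamma -> R[i]}).
Hypotheses (d0 : (0 < d)%N) (a0 : forall j, a j != 0) (xi : injective x)
  (xb : forall j, half_ball (x j))
  (GN : forall k, k \in Gamma -> - N%:Z <= k <= N%:Z)
  (Th1 : forall th, th \in Theta -> enorm th = 1)
  (A1 : condA1 a x L' Theta' c).
Let mu0 := discrete_cm a x.
Let y0 := Phi Gamma Theta mu0.

Lemma condA1_le1 th : th \in Theta' -> forall t, `|trig_poly (c th) t| <= 1.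
Proof. by move=> thT; case: A1 => _ /(_ th thT) [/supnorm_le1]. Qed.

Lemma condA1_int th : th \in Theta' ->
  complex.Re (cm_int mu0 (certificate (c th) (val th))) = \sum_j normc (a j).
Proof.
move=> thT; apply: cm_int_certificate_sign => // j.
by case: A1 => _ /(_ th thT) [_].
Qed.

Lemma TVnorm_ge_of_Phi nu : (exists th, th \in Theta') -> Phi Gamma Theta nu = y0 ->
  ((\sum_j normc (a j))%:E <= TVnorm nu)%E.
Proof.
move=> [th thT] nuy; rewrite -(condA1_int _ thT) -(cm_int_certificate_ext _ th _ _ nuy).
apply: TVnorm_ge_Re_int; first exact: bounded_mfun_certificate.
by apply: certificate_le1; exact: condA1_le1.
Qed.

Lemma supported_mu0 : supported_in (@half_ball R d) mu0.
Proof.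
move=> A mA AX; apply: (@cm_null_discrete _ _ 0 _ a x (@half_ball R d)) => //.
by move=> y Ay yb; have : (A `&` @half_ball R d) y by []; rewrite AX.
Qed.

Lemma P0_solution_mu0 : (exists th, th \in Theta') -> P0_solution y0 mu0.
Proof.
move=> T0; split; first by split; [exact: supported_mu0|].
move=> nu [_ nuy]; apply: le_trans (TVnorm_discrete _ _) _.
exact: TVnorm_ge_of_Phi.
Qed.

(** Both measures are solutions, so [minimizer_concentrated] applies to both. *)
Lemma P0_solution_unique m (xt : 'I_m -> 'rV[R]_d) nu :
  good_enum c Theta' xt -> P0_solution y0 nu -> cm_eq nu mu0.
Proof.
move=> [xti xtE Ai] [[sup nuy] nuM].
have T0 := Theta'_nonempty _ _ _ _ _ _ d0 xtE.
have conc mu : supported_in (@half_ball R d) mu -> Phi Gamma Theta mu = y0 ->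
    (TVnorm mu <= TVnorm mu0)%E -> cm_null mu (~` range xt).
  move=> smu muy muM; apply: (minimizer_concentrated _ _ _ _ _ _ Th1 T0 xtE smu).
    exact: condA1_le1.
  move=> th thT; rewrite (cm_int_certificate_ext _ th _ _ muy) condA1_int//.
  by apply: (le_trans muM); exact: TVnorm_discrete.
apply: (cm_eq_concentrated Gamma Theta xt) => //.
- by apply: conc => //; apply: nuM; split => //; exact: supported_mu0.
- by apply: conc => //; exact: supported_mu0.
Qed.

(** The objective is the pairing of mu0 with the certificate, which duality
    bounds by sum_j |a_j|; interpolation of the signs attains the bound. *)
Lemma condA1_maximizer th : th \in Theta' ->
  sdp_maximizer [ffun k => y0 (k, th)] (extend_coef N Gamma (c th)).
Proof.
move=> thT; split.
  apply/sdp_feasible_trig => //; split; first exact: extend_coef0.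
  by rewrite extend_coefK//; exact: condA1_le1.
move=> c' Q' F'.
have oE := @sdp_objective_certificate R d N Gamma Theta mu0 th.
rewrite /y0 (oE c') (oE (extend_coef N Gamma (c th))) extend_coefK//.
rewrite (condA1_int _ thT).
have [_ c'1] := (sdp_feasible_trig N Gamma c' GN).1 (ex_intro _ Q' F').
rewrite cm_int_certificate_discrete raddf_sum ler_sum// => j _; exact: Re_pairing_le.
Qed.

Lemma step1_outcome_exists : exists C : Theta -> 'cV[R[i]]_(N.*2.+1),
  step1_outcome y0 C /\ forall th, th \in Theta' -> restrict_coef Gamma (C th) = c th.
Proof.
have h th := cid (sdp_maximizer_exists N Gamma [ffun k => y0 (k, th)] GN).
exists (fun th => if th \in Theta' then extend_coef N Gamma (c th) else projT1 (h th)); split.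
  move=> th; case: ifPn => thT; first exact: condA1_maximizer.
  exact: projT2 (h th).
by move=> th ->; exact: extend_coefK.
Qed.

(** The support of mu0 is shown to lie in the finite set computed from the
    returned subset of directions, by the averaging argument: L' pairings, each
    at most sum |a_j|, have the sum L' sum |b_j| >= L' sum |a_j|. *)
Lemma step2_returns_mu0 (C : Theta -> 'cV[R[i]]_(N.*2.+1)) nu :
  (exists th, th \in Theta') ->
  step1_outcome y0 C -> step2_returns L' y0 (fun th => restrict_coef Gamma (C th)) nu ->
  cm_eq nu mu0.
Proof.
move=> T0 oC [Th2 [m [xt [b [cTh2 [xti xtE Ai] Ab sg ->]]]]].
set cS := fun th => restrict_coef Gamma (C th) in xtE sg.
have T2 := Theta'_nonempty _ _ _ _ _ _ d0 xtE.
have cS1 th t : `|trig_poly (cS th) t| <= 1.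
  by have [/(sdp_feasible_trig N Gamma (C th) GN)[_]] := oC th.
have Pb : Phi Gamma Theta (discrete_cm b xt) = y0.
  by rewrite Phi_discrete -Ab; congr Amap; apply/ffunP => j; rewrite ffunE.
have n0 : (0 < #|Th2|)%N by apply/card_gt0P; case: T2 => th ?; exists th.
have sumb : \sum_(th in Th2) complex.Re (cm_int mu0 (certificate (cS th) (val th))) =
    #|Th2|%:R * \sum_j normc (b j).
  under eq_bigr do rewrite -(cm_int_certificate_ext _ _ _ _ Pb) cm_int_certificate_discrete.
  rewrite -raddf_sum exchange_big raddf_sum mulr_sumr; apply: eq_bigr => j _ /=.
  rewrite -mulr_sumr -rmorph_sum.
  have [->|bj] := eqVneq (b j) 0; first by rewrite mul0r ComplexField.Normc.normc0 mulr0.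
  have -> : \sum_(th in Th2) trig_poly (cS th) (dot (val th) (xt j)) = #|Th2|%:R * csgn (b j).
    rewrite sg// mulVKf ?pnatr_eq0 -?lt0n//.
    by apply: eq_bigr => th _; rewrite dotC.
  rewrite rmorphM/= conjC_nat mulrCA mul_csgn_conj// normc_norm.
  by rewrite -[_%:R](rmorph_nat (real_complex R)) -rmorphM.
have ab : \sum_j normc (a j) <= \sum_j normc (b j).
  rewrite -lee_fin; apply: (@le_trans _ _ (TVnorm (discrete_cm b xt))).
    exact: TVnorm_ge_of_Phi.
  exact: TVnorm_discrete.
have le_a th : complex.Re (cm_int mu0 (certificate (cS th) (val th))) <= \sum_j normc (a j).
  rewrite cm_int_certificate_discrete raddf_sum ler_sum// => j _; exact: Re_pairing_le.
have eq_a th : th \in Th2 ->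
    \sum_j normc (a j) <= complex.Re (cm_int mu0 (certificate (cS th) (val th))).
  move=> thT; have : #|Th2|%:R * \sum_j normc (a j) <=
      \sum_(th in Th2) complex.Re (cm_int mu0 (certificate (cS th) (val th))).
    by rewrite sumb ler_wpM2l.
  rewrite mulr_natl -sumr_const (bigD1 th)//= [leRHS](bigD1 th)//= => h.
  have h2 : \sum_(i in Th2 | i != th) complex.Re (cm_int mu0 (certificate (cS i) (val i))) <=
     \sum_(i in Th2 | i != th) \sum_j normc (a j) by apply: ler_sum.
  by rewrite -(lerD2r (\sum_(i in Th2 | i != th) \sum_j normc (a j))) (le_trans h)// lerD2l.
have xD j : range xt (x j).
  rewrite xtE; apply: mem_tDelta => // th thT.
  have := eq_a th thT; rewrite cm_int_certificate_discrete.
  by move/(Re_pairing_sum_eq a (fun j => trig_poly (cS th) (dot (val th) (x j)))); apply.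
apply: (cm_eq_concentrated Gamma Theta xt) => //.
- by apply: (cm_null_discrete (m := 0)) => j; exists j.
- exact: (cm_null_discrete (m := 0)).
Qed.

(** The masses of mu0 at the points of tDelta solve the linear system; a nonzero
    mass sits at some x_i and equals a_i, so that the sign test is the
    interpolation property of the p_th. *)
Lemma step2_returns_exists (cS : Theta -> {ffun Gamma -> R[i]}) m (xt : 'I_m -> 'rV[R]_d) :
  good_enum c Theta' xt -> (forall th, th \in Theta' -> cS th = c th) ->
  exists nu, step2_returns L' y0 cS nu.
Proof.
move=> [xti xtE Ai] cSc.
have [cT A1'] := A1.
have T0 := Theta'_nonempty _ _ _ _ _ _ d0 xtE.
have n0 : (0 < #|Theta'|)%N by apply/card_gt0P; case: T0 => th ?; exists th.
have tE : tDelta cS Theta' = tDelta c Theta'.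
  by apply: eq_bigcapr => th thT; rewrite cSc.
have xD j : range xt (x j).
  rewrite xtE; apply: mem_tDelta => // th thT.
  by have [_ ->] := A1' th thT; rewrite normc_csgn.
have conc : cm_null mu0 (~` range xt) by exact: (cm_null_discrete (m := 0)).
pose b : {ffun 'I_m -> R[i]} := [ffun j => point_masses mu0 xt j].
exists (discrete_cm b xt), Theta', m, xt, b; split => //.
- by split => //; rewrite tE.
- by rewrite -Phi_discrete -(Phi_ext _ _ _ _ (concentrated_discrete _ _ xti conc)).
move=> j; rewrite /b ffunE /point_masses cm_val_discrete => bj.
have [i xij] : exists i, x i = xt j.
  apply: contrapT => nx; move: bj; rewrite big1 ?eqxx// => i _.
  by rewrite indicE memNset ?mulr0//= => xij; apply: nx; exists i.
rewrite (bigD1 i)//= big1 ?addr0; last first.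
  move=> k ki; rewrite indicE memNset ?mulr0//= -xij => /xi kE.
  by rewrite kE eqxx in ki.
rewrite indicE mem_set//= mulr1.
have -> : \sum_(th in Theta') trig_poly (cS th) (dot (xt j) (val th)) =
    #|Theta'|%:R * csgn (a i).
  rewrite mulr_natl -sumr_const; apply: eq_bigr => th thT.
  by rewrite cSc// dotC -xij; have [_ ->] := A1' th thT.
by rewrite mulKf// pnatr_eq0 -lt0n.
Qed.

End Recovery.

Theorem proposition2p1 (R : realType) (d M N T L L' : nat)
    (a : 'I_M -> R[i]) (x : 'I_M -> 'rV[R]_d)
    (Gamma : {fset int}) (Theta : {fset 'rV[R]_d})
    (Theta' : {set Theta}) (c : Theta -> {ffun Gamma -> R[i]}) :
  (2 <= d)%N ->
  (forall j, a j != 0) -> injective x -> (forall j, half_ball (x j)) ->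
  (forall k, k \in Gamma -> - N%:Z <= k <= N%:Z) -> #|` Gamma| = T ->
  (forall th, th \in Theta -> enorm th = 1) -> #|` Theta| = L ->
  (L' <= L)%N ->
  let mu0 := discrete_cm a x in
  let y0 := Phi Gamma Theta mu0 in
  condA1 a x L' Theta' c ->
  condA2 Theta' c ->
  (* mu0 is the unique solution of the minimisation problem *)
  (P0_solution y0 mu0 /\ forall nu, P0_solution y0 nu -> cm_eq nu mu0) /\
  (* Step 1 can produce the polynomials of (A1) *)
  (exists C : Theta -> 'cV[R[i]]_(N.*2.+1), step1_outcome y0 C /\
     forall th, th \in Theta' -> restrict_coef Gamma (C th) = c th) /\
  (* whatever maximizers Step 1 produces, a returned measure is mu0, and Step 2
     does return when Step 1 has produced the polynomials of (A1) *)
  (forall C : Theta -> 'cV[R[i]]_(N.*2.+1), step1_outcome y0 C ->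
     let cS := fun th => restrict_coef Gamma (C th) in
     (forall nu, step2_returns L' y0 cS nu -> cm_eq nu mu0) /\
     ((forall th, th \in Theta' -> cS th = c th) ->
        exists nu, step2_returns L' y0 cS nu)).
Proof.
move=> d2 a0 xi xb GN _ Th1 _ _ mu0 y0 A1 [m [xt xtG]].
have d0 : (0 < d)%N by exact: ltnW.
have T0 : exists th, th \in Theta'.
  by case: xtG => _ xtE _; exact: (Theta'_nonempty _ _ _ _ _ _ d0 xtE).
split; [split|split].
- exact: (P0_solution_mu0 a x Gamma Theta Theta' c a0 xb A1 T0).
- move=> nu; exact: (P0_solution_unique a x Gamma Theta Theta' c d0 a0 xb Th1 A1 m xt nu xtG).
- exact: (step1_outcome_exists a x Gamma Theta Theta' c a0 GN A1).
- move=> C oC; split.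
    move=> nu.
    exact: (step2_returns_mu0 a x Gamma Theta Theta' c d0 a0 xb GN Th1 A1 C nu T0 oC).
  exact: (step2_returns_exists a x Gamma Theta Theta' c d0 a0 xi xb Th1 A1 _ m xt xtG).
Qed.
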